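(* Let $\widehat L:BUC_\eta\to\mathbb{R}^n$ be a bounded linear operator. The essential growth bound of $(A+L)_0$ satisfies $$\omega_{0,ess}((A+L)_0)\le\omega_{0,ess}(A_0)\le-\eta .$$
   Context: Fix an integer $n\ge1$ and a real $\eta>0$. $BUC_\eta$ is the Banach space of all $\varphi\in C((-\infty,0],\mathbb{R}^n)$ such that $\theta\mapsto e^{\eta\theta}\varphi(\theta)$ is bounded and uniformly continuous, with norm $\|\varphi\|_\eta=\sup_{\theta\le0}e^{\eta\theta}\|\varphi(\theta)\|$; $BUC_\eta^1=\{\varphi\in C^1:\varphi,\varphi'\in BUC_\eta\}$. $X=\mathbb{R}^n\times BUC_\eta$ with norm $\|(\alpha,\varphi)\|=\|\alpha\|+\|\varphi\|_\eta$. $A:D(A)\subset X\to X$, $A(0,\varphi)=(-\varphi'(0),\varphi')$, $D(A)=\{0_{\mathbb{R}^n}\}\times BUC_\eta^1$, with $\overline{D(A)}=\{0_{\mathbb{R}^n}\}\times BUC_\eta$. $L:\overline{D(A)}\to X$, $L(0,\varphi)=(\widehat L(\varphi),0)$. $A_0$ (resp. $(A+L)_0$) is the part of $A$ (resp. $A+L$) in $\overline{D(A)}$: both act by $(0,\varphi)\mapsto(0,\varphi')$, with domains $\{(0,\varphi):\varphi\in BUC_\eta^1,\varphi'(0)=0\}$ and $\{(0,\varphi):\varphi\in BUC_\eta^1,\varphi'(0)=\widehat L(\varphi)\}$ respectively. Each generates a strongly continuous semigroup of bounded linear operators on $\overline{D(A)}$. For a generator $B$ of a $C_0$-semigroup $\{T_B(t)\}_{t\ge0}$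 on a Banach space $Y$, $\omega_{0,ess}(B)=\lim_{t\to+\infty}\frac{\ln\|T_B(t)\|_{ess}}{t}\in[-\infty,+\infty)$ (with $\ln0=-\infty$), where $\|T\|_{ess}=\kappa(T(B_Y(0,1)))$, $B_Y(0,1)$ is the closed unit ball, and $\kappa(S)=\inf\{\varepsilon>0:S\text{ can be covered by finitely many balls of radius}\le\varepsilon\}$ for bounded $S\subset Y$. *)

(* Defs.v *)
From HB Require Import structures.
From mathcomp Require Import all_boot all_order all_algebra.
From mathcomp Require Import all_classical all_reals all_analysis.
Set Implicit Arguments.
Unset Strict Implicit.
Unset Printing Implicit Defensive.
Import Order.TTheory GRing.Theory Num.Theory.
Import numFieldNormedType.Exports.
Local Open Scope classical_set_scope.
Local Open Scope ring_scope.

(* R^n with an arbitrary norm, rather than only the max norm that the library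
   puts on 'rV[R]_n. *)
Record rVnorm (R : realType) (n : nat) := RVNorm {
  rVnorm_fun :> 'rV[R]_n -> R;
  rVnormD : forall x y, rVnorm_fun (x + y) <= rVnorm_fun x + rVnorm_fun y;
  rVnormZ : forall a x, rVnorm_fun (a *: x) = `|a| * rVnorm_fun x;
  rVnorm_eq0 : forall x, rVnorm_fun x = 0 -> x = 0 }.

Definition normed_rV (R : realType) (n : nat) (N : rVnorm R n) : Type :=
  'rV[R]_n.

Section NormedRV.
Context (R : realType) (n : nat) (N : rVnorm R n).
HB.instance Definition _ := GRing.Lmodule.copy (normed_rV N) 'rV[R]_n.
HB.instance Definition _ := Lmodule_isNormed.Build R (normed_rV N)
  (@rVnormD R n N) (@rVnormZ R n N) (@rVnorm_eq0 R n N).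
End NormedRV.

(* The library's product of normed modules carries the max norm. *)
Definition l1prod (R : realType) (V W : normedModType R) : Type := (V * W)%type.

Section L1Prod.
Context (R : realType) (V W : normedModType R).
HB.instance Definition _ := GRing.Lmodule.copy (l1prod V W) (V * W)%type.

Definition l1prod_norm (x : l1prod V W) : R := `|x.1| + `|x.2|.

Lemma l1prod_normD x y : l1prod_norm (x + y) <= l1prod_norm x + l1prod_norm y.
Proof. by rewrite /l1prod_norm addrACA lerD// ler_normD. Qed.

Lemma l1prod_normZ a x : l1prod_norm (a *: x) = `|a| * l1prod_norm x.
Proof. by rewrite /l1prod_norm !normrZ mulrDr. Qed.

Lemma l1prod_norm_eq0 x : l1prod_norm x = 0 -> x = 0.
Proof.
case: x => x y /eqP; rewrite paddr_eq0 ?normr_ge0// !normr_eq0 /=.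
by move=> /andP[/eqP -> /eqP ->].
Qed.

HB.instance Definition _ := Lmodule_isNormed.Build R (l1prod V W)
  l1prod_normD l1prod_normZ l1prod_norm_eq0.
End L1Prod.

(* Unbounded operators of X are represented by their graphs, and a semigroup on
   a closed subspace Y of X by maps X -> X whose values outside Y are
   irrelevant. *)
Section Operators.
Context (R : realType) (X : normedModType R).
Implicit Types (A B : set (X * X)) (Y : set X) (T : R -> X -> X).

Definition op_dom A : set X := [set x | exists y, A (x, y)].

Definition op_add A B : set (X * X) :=
  [set p | exists y z, [/\ A (p.1, y), B (p.1, z) & p.2 = y + z]].

Definition op_part Y A : set (X * X) := [set p | [/\ A p, Y p.1 & Y p.2]].

Record C0_semigroup Y T : Prop := {
  C0_stable : forall t x, 0 <= t -> Y x -> Y (T t x);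
  C0_linear : forall t a x y, 0 <= t -> Y x -> Y y ->
    T t (a *: x + y) = a *: T t x + T t y;
  C0_bounded : forall t, 0 <= t ->
    exists M : R, forall x, Y x -> `|T t x| <= M * `|x|;
  C0_0 : forall x, Y x -> T 0 x = x;
  C0_D : forall s t x, 0 <= s -> 0 <= t -> Y x -> T (s + t) x = T s (T t x);
  C0_continuous : forall x, Y x -> T t x @[t --> 0^'+] --> x }.

Definition semigroup_generator Y T : set (X * X) :=
  [set p | Y p.1 /\ h^-1 *: (T h p.1 - p.1) @[h --> 0^'+] --> p.2].

Definition generates Y B T : Prop :=
  C0_semigroup Y T /\ semigroup_generator Y T = B.

Definition finite_ball_cover Y (S : set X) (e : R) : Prop :=
  exists s : seq (X * R),
    (forall c, c \in s -> Y c.1 /\ c.2 <= e) /\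
    S `<=` [set x | exists2 c, c \in s & (Y `&` closed_ball_ Num.norm c.1 c.2) x].

Definition kappa Y (S : set X) : \bar R :=
  ereal_inf [set e%:E | e in [set e : R | 0 < e /\ finite_ball_cover Y S e]].

Definition ess_norm Y (F : X -> X) : \bar R :=
  kappa Y (F @` (Y `&` closed_ball_ Num.norm 0 1)).

Definition ess_growth_bound Y T : \bar R :=
  lim ((lne (ess_norm Y (T t)) * (t^-1)%:E)%E @[t --> +oo]).

End Operators.

(* The type of nonpositive reals, with the topology and uniformity induced by
   R: a punctured neighborhood of 0 in it is one-sided. *)
Notation half_line R := (set_type (`]-oo, (0 : R)]%classic : set R)).

Lemma half_line0_subproof (R : realType) :
  (0 : R) \in (`]-oo, (0 : R)]%classic : set R).
Proof. by rewrite inE /= in_itv /= lexx. Qed.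

Definition half_line0 (R : realType) : half_line R :=
  exist _ 0 (half_line0_subproof R).

Section BUC.
Context (R : realType) (V : normedModType R) (eta : R).

Definition weighted (phi : half_line R -> V) (x : half_line R) : V :=
  expR (eta * \val x) *: phi x.

Definition is_BUC : set (half_line R -> V) :=
  [set phi | [/\ continuous phi, bounded_fun (weighted phi)
                & unif_continuous (weighted phi)]].


Definition BUC_pred : {pred half_line R -> V} := mem is_BUC.

Lemma weighted_lin a phi psi x :
  weighted (a *: phi + psi) x = a *: weighted phi x + weighted psi x.
Proof.
rewrite /weighted -[(a *: phi + psi) x]/(a *: phi x + psi x).
by rewrite scalerDr !scalerA mulrC.
Qed.

Lemma is_BUC_submod_closed : submod_closed BUC_pred.
Proof.
split=> [|a phi psi]; rewrite !inE.
  have w0 x : weighted 0 x = 0 by rewrite /weighted scaler0.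
  split; first exact: cst_continuous.
    by exists 0; split=> // r r0 x _; rewrite /= w0 normr0 ltW.
  apply/unif_continuousP => e e0; exists 1 => // x _.
  by rewrite !w0; exact: ballxx.
move=> [phic [M [_ phib]] phiu] [psic [K [_ psib]] psiu]; split.
- move=> x; apply: (@cvgD _ _ _ (nbhs x) _ (a \*: phi) psi).
    by apply: cvgZl_tmp; exact: phic.
  exact: psic.
- exists (`|a| * (M + 1) + (K + 1)); split; first exact: num_real.
  move=> r /ltW ltr x _; apply: le_trans ltr.
  rewrite weighted_lin (le_trans (ler_normD _ _))// normrZ lerD//.
    by rewrite ler_wpM2l// phib// ltrDl.
  by rewrite psib// ltrDl.
apply/unif_continuousP => e e0.
have a0 : 0 < `|a| + 1 by rewrite ltr_wpDl.
have e20 : 0 < e / 2 by rewrite divr_gt0.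
have d0 : 0 < e / 2 / (`|a| + 1) by rewrite divr_gt0.
have /unif_continuousP/(_ _ d0)[d1 d10 Hphi] := phiu.
have /unif_continuousP/(_ _ e20)[d2 d20 Hpsi] := psiu.
exists (Num.min d1 d2) => [|x xy]; first by rewrite lt_min d10.
rewrite -ball_normE /ball_/= !weighted_lin opprD addrACA -scalerBr.
rewrite (le_lt_trans (ler_normD _ _))// [ltRHS]splitr ler_ltD//; last first.
  have /Hpsi : ball x.1 d2 x.2 by apply: le_ball xy; rewrite ge_min lexx orbT.
  by rewrite -ball_normE.
have /Hphi : ball x.1 d1 x.2 by apply: le_ball xy; rewrite ge_min lexx.
rewrite -ball_normE /ball_/= normrZ => /ltW H.
rewrite (le_trans (ler_wpM2l (normr_ge0 a) H))//.
by rewrite mulrCA ler_piMr ?(ltW e20)// ler_pdivrMr ?mul1r ?lerDl.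
Qed.


HB.instance Definition _ :=
  GRing.isSubmodClosed.Build R (half_line R -> V) BUC_pred
    is_BUC_submod_closed.

Record BUC := MkBUC {
  BUC_fun :> half_line R -> V; _ : BUC_fun \in BUC_pred }.

HB.instance Definition _ := [isSub for BUC_fun].
HB.instance Definition _ := [Choice of BUC by <:].
HB.instance Definition _ := [SubChoice_isSubLmodule of BUC by <:].


Definition BUC_norm (phi : BUC) : R :=
  sup [set expR (eta * \val x) * `|phi x| | x in [set: half_line R]].

Lemma BUC_has_sup (phi : BUC) :
  has_sup [set expR (eta * \val x) * `|phi x| | x in [set: half_line R]].
Proof.
split; first by exists (expR (eta * 0) * `|phi (half_line0 R)|), (half_line0 R).
have := valP phi; rewrite inE => -[_ [M [_ H]] _].
exists (M + 1) => _ [x _ <-]; have := H (M + 1) _ x I.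
by rewrite /weighted /= normrZ gtr0_norm ?expR_gt0//; apply; rewrite ltrDl.
Qed.

Lemma BUC_norm_ub (phi : BUC) x :
  expR (eta * \val x) * `|phi x| <= BUC_norm phi.
Proof. by apply: ub_le_sup; [case: (BUC_has_sup phi)|exists x]. Qed.

Lemma BUC_norm_le (phi : BUC) (M : R) :
  (forall x, expR (eta * \val x) * `|phi x| <= M) -> BUC_norm phi <= M.
Proof.
move=> H; apply: ge_sup; first by case: (BUC_has_sup phi).
by move=> _ [x _ <-].
Qed.

Lemma BUC_normD phi psi : BUC_norm (phi + psi) <= BUC_norm phi + BUC_norm psi.
Proof.
apply: BUC_norm_le => x; rewrite -[(phi + psi) x]/(phi x + psi x).
rewrite (@le_trans _ _ (expR (eta * \val x) * (`|phi x| + `|psi x|)))//.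
  by rewrite ler_wpM2l ?expR_ge0// ler_normD.
by rewrite mulrDr lerD// BUC_norm_ub.
Qed.

Lemma BUC_norm_le_scale a phi : BUC_norm (a *: phi) <= `|a| * BUC_norm phi.
Proof.
apply: BUC_norm_le => x; rewrite -[(a *: phi) x]/(a *: phi x).
by rewrite normrZ mulrCA ler_wpM2l// BUC_norm_ub.
Qed.

Lemma BUC_norm_eq0 phi : BUC_norm phi = 0 -> phi = 0.
Proof.
move=> phi0; apply/val_inj/funext => x; apply/eqP.
rewrite -[_ == _]/(phi x == 0) -normr_le0.
by have := BUC_norm_ub phi x; rewrite phi0 pmulr_rle0 ?expR_gt0.
Qed.

Lemma BUC_normZ a phi : BUC_norm (a *: phi) = `|a| * BUC_norm phi.
Proof.
apply/le_anti; rewrite BUC_norm_le_scale /=.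
have [->|a0] := eqVneq a 0.
  rewrite normr0 mul0r; apply: le_trans (BUC_norm_ub _ (half_line0 R)).
  by rewrite mulr_ge0 ?expR_ge0.
have := BUC_norm_le_scale a^-1 (a *: phi).
by rewrite scalerA mulVf// scale1r normfV ler_pdivlMl ?normr_gt0.
Qed.

HB.instance Definition _ := Lmodule_isNormed.Build R BUC
  BUC_normD BUC_normZ BUC_norm_eq0.

Definition half_line_derivative (phi psi : half_line R -> V) : Prop :=
  forall x : half_line R,
    (\val y - \val x)^-1 *: (phi y - phi x) @[y --> x^'] --> psi x.

(* [BUC_derivative phi phi'] means that phi is in BUC^1 with derivative phi';
   membership of phi' in BUC includes its continuity. *)
Definition BUC_derivative (phi phi' : BUC) : Prop :=
  half_line_derivative phi phi'.

Notation X := (l1prod V BUC).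

Definition op_A : set (X * X) :=
  [set p | exists phi phi' : BUC, BUC_derivative phi phi' /\
     p = ((0, phi), (- phi' (half_line0 R), phi'))].

Definition X0 : set X := closure (op_dom op_A).

Definition op_L (Lhat : BUC -> V) : set (X * X) :=
  [set p | X0 p.1 /\ p.2 = (Lhat p.1.2, 0)].

Definition op_A0 : set (X * X) := op_part X0 op_A.

Definition op_AL0 (Lhat : BUC -> V) : set (X * X) :=
  op_part X0 (op_add op_A (op_L Lhat)).

End BUC.

Arguments BUC_derivative {R V eta}.
Arguments op_A {R} V eta.
Arguments X0 {R} V eta.
Arguments op_A0 {R} V eta.
Arguments op_L {R V eta}.
Arguments op_AL0 {R V eta}.

Notation state_space V eta := (l1prod V (BUC V eta)).

(* Main.v *)
From HB Require Import structures.
Require Import Defs.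
From mathcomp Require Import all_boot all_order all_algebra.
From mathcomp Require Import all_classical all_reals all_analysis.
From mathcomp Require Import ring lra zify.
Set Implicit Arguments.
Unset Strict Implicit.
Unset Printing Implicit Defensive.
Import Order.TTheory GRing.Theory Num.Theory.
Import numFieldNormedType.Exports.
Local Open Scope classical_set_scope.
Local Open Scope ring_scope.

(** Both essential growth bounds are equal to [- eta], whatever the bounded
    operator [Lhat]; and the unperturbed operator is the case [Lhat = 0].

    A state in the domain of the generator evolves by [u' = du/dtheta], so the
    flow is constant along the lines [t + theta = const]. Hence [u t theta] is
    the initial value [phi (t + theta)] as long as [t + theta <= 0], and
    otherwise the boundary value [z (t + theta)], where [z s = u s 0] has the
    right derivative [Lhat (u s)] ([characteristics_constant]). Gronwall's
    inequality bounds [z], so [z] is Lipschitz on bounded time intervals with a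
    constant common to the unit ball ([flow_boundary_lipschitz]).

    Upper bound. On [[-t, 0]] the states issued from the unit ball form a bounded
    equi-Lipschitz family, hence fall into finitely many classes of small
    diameter. Left of [-t] the weight shrinks the translate of the initial value
    by [exp (- eta * t)]. So the essential norm is at most [2 * exp (- eta * t)]
    ([flow_finite_classes], [ess_norm_upper]).

    Lower bound. Infinitely many disjoint bumps of weighted norm [1], placed
    further and further to the left, are merely translated, and their images
    keep a mutual distance of at least [exp (- eta * t)]. So the essential norm
    is at least half of that ([ess_norm_lower]).

    The logarithms of the two bounds, divided by [t], both tend to [- eta].

    Two points need care. First, the flow along characteristics is integrated
    from right derivatives, which requires orbits to be left continuous. This is
    obtained without a uniform bound on the semigroup near time [0], from Baire's
    theorem on the real line and the semigroup law
    ([semigroup_left_continuous]). Second, the formulas hold on the domain of the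
    generator and extend by density. The domain is dense because averages of
    [phi] are continuously differentiable ([BUC_C1_dense]) and because a small
    steep exponential restores the boundary condition ([BUC_domain_dense]). *)

(** * Functions of a real variable controlled from one side *)

Lemma near0_rightP (R : realType) (P : R -> Prop) :
  (\forall h \near 0^'+, P h) <-> exists2 d, 0 < d & forall h, 0 < h < d -> P h.
Proof.
split=> [[d d0 H]|[d d0 H]].
  exists d => // h /andP[h0 hd]; apply: H => //=.
  by rewrite sub0r normrN gtr0_norm.
near=> h; apply: H; apply/andP; split; near: h; first exact: nbhs_right_gt.
exact: nbhs_right_lt.
Unshelve. all: by end_near. Qed.

(** Otherwise let [s] be the infimum of the counterexamples in [[a, b]]. The
    first hypothesis gives [P s], and the second pushes [P] past [s], which
    contradicts the choice of [s]. *)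
Lemma real_induction (R : realType) (P : R -> Prop) (a b : R) :
  (forall x, a <= x <= b -> (forall y, a <= y < x -> P y) -> P x) ->
  (forall x, a <= x < b -> (forall y, a <= y <= x -> P y) ->
     \forall h \near 0^'+, P (x + h)) ->
  forall x, a <= x <= b -> P x.
Proof.
move=> Pleft Pright x1 /andP[ax1 x1b]; apply: contrapT => nPx1.
pose S := [set x | a <= x <= b /\ ~ P x].
have S1 : S x1 by split=> //; rewrite ax1.
have Sinf : has_inf S by split; [exists x1 | exists a => x [/andP[]]].
have as_ : a <= inf S by apply: lb_le_inf; [exists x1 | move=> x [/andP[]]].
have Slb x : S x -> inf S <= x by move=> Sx; apply: ge_inf => //; case: Sinf.
have below y : a <= y < inf S -> P y.
  move=> /andP[ay ys]; apply: contrapT => nPy.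
  have /Slb : S y by split=> //; rewrite ay (le_trans (ltW ys))// (le_trans (Slb _ S1)).
  by rewrite leNgt ys.
have Ps : P (inf S) by apply: Pleft => //; rewrite as_ (le_trans (Slb _ S1)).
have sx1 : inf S < x1.
  rewrite lt_neqAle Slb// andbT; apply/eqP => sx1.
  by apply: nPx1; rewrite -sx1.
have /near0_rightP[d d0 H] : \forall h \near 0^'+, P (inf S + h).
  apply: Pright; first by rewrite as_ (lt_le_trans sx1).
  move=> y /andP[ay]; rewrite le_eqVlt => /orP[/eqP->//|ys].
  by apply: below; rewrite ay.
have : inf S + d <= inf S.
  apply: lb_le_inf; first by exists x1.
  move=> x Sx; rewrite leNgt; apply/negP => xd.
  have := Slb _ Sx; rewrite le_eqVlt => /orP[/eqP sx|sx].
    by case: Sx => _; rewrite -sx.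
  case: Sx => _; apply; rewrite -(subrKC (inf S) x); apply: H.
  by rewrite subr_gt0 sx ltrBlDl.
by rewrite gerDl leNgt d0.
Qed.

Definition left_continuous_at (R : realType) (V : normedModType R)
  (g : R -> V) (x : R) := forall e, 0 < e -> \forall h \near 0^'+, `|g x - g (x - h)| <= e.

(** One-sided slopes suffice, because real induction only moves to the right;
    left continuity is what carries the estimate across a limit of smaller
    points. A semigroup orbit is differentiated most directly from the right,
    so this is the form in which all orbits below are integrated. *)
Lemma mean_value_right (R : realType) (V : normedModType R) (g : R -> V)
    (a b K : R) : a <= b -> 0 <= K ->
  (forall x, a < x <= b -> left_continuous_at g x) ->
  (forall x, a <= x < b -> forall e, 0 < e ->
     \forall h \near 0^'+, `|g (x + h) - g x| <= (K + e) * h) ->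
  `|g b - g a| <= K * (b - a).
Proof.
move=> ab K0 gl gr.
suff H e : 0 < e -> `|g b - g a| <= (K + e) * (b - a).
  apply/ler_addgt0Pr => e e0.
  have d0 : 0 < b - a + 1 by rewrite ltr_wpDl// subr_ge0.
  have /H/le_trans : 0 < e / (b - a + 1) by rewrite divr_gt0.
  apply; rewrite mulrDl lerD2l mulrAC ler_pdivrMr// ler_pM2l//.
  by rewrite lerDl.
move=> e0; have Ke : 0 < K + e by rewrite ltr_wpDl.
suff: forall x, a <= x <= b -> `|g x - g a| <= (K + e) * (x - a).
  by apply; rewrite ab lexx.
apply: real_induction => [x /andP[ax xb] IH|x /andP[ax xb] IH].
  move: ax; rewrite le_eqVlt => /orP[/eqP <-|ax].
    by rewrite !subrr normr0 mulr0.
  apply/ler_addgt0Pr => e' e'0.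
  have /near0_rightP[d d0 H] : \forall h \near 0^'+, `|g x - g (x - h)| <= e'.
    by apply: gl => //; rewrite ax.
  pose h := Num.min d (x - a) / 2.
  have m0 : 0 < Num.min d (x - a) by rewrite lt_min d0 subr_gt0.
  have hm : h < Num.min d (x - a) by rewrite ltr_pdivrMr// ltr_pMr// ltr1n.
  have h0 : 0 < h by rewrite divr_gt0.
  move: hm; rewrite lt_min => /andP[hd hxa].
  have g1 := H h; rewrite h0 hd in g1.
  have g2 := IH (x - h).
  have := g2 _; rewrite lerBrDr -lerBrDl (ltW hxa) ltrBlDr ltrDl h0 => /(_ isT) g3.
  rewrite -(subrKA (g (x - h))) (le_trans (ler_normD _ _))// addrC lerD//; last exact: g1.
  rewrite (le_trans g3)// ler_pM2l// lerB//.
  by rewrite gerBl ltW.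
have IHx := IH x; rewrite ax lexx in IHx; have {}IHx := IHx isT.
have grx : \forall h \near 0^'+, `|g (x + h) - g x| <= (K + e) * h.
  by apply: gr => //; rewrite ax.
near=> h.
rewrite -(subrKA (g x)) (le_trans (ler_normD _ _))//.
rewrite (_ : x + h - a = h + (x - a)); last by rewrite addrAC addrC.
rewrite mulrDr lerD//.
by near: h.
Unshelve. all: by end_near. Qed.

(** Right continuity at [t] makes the oscillation of [g] small on an interval
    with left end [t]. Hence the points with a neighborhood of oscillation at
    most [1 / (k + 1)] form a dense open set, and by Baire's theorem some
    point of [(0, d)] lies in all of them. *)
Lemma exists_left_continuous_at (R : realType) (V : normedModType R)
    (g : R -> V) (d : R) : 0 < d ->
  (forall t : R, 0 <= t -> g (t + h) @[h --> 0^'+] --> g t) ->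
  exists2 t, 0 < t < d & left_continuous_at g t.
Proof.
move=> d0 gr.
(* The negative numbers, about which the hypothesis says nothing, are put into
   every [O k] to make it dense in the whole line. *)
pose O (k : nat) : set R^o := [set t : R | t < 0 \/ exists2 r : R, 0 < r &
  forall x y : R, `|t - x| < r -> `|t - y| < r -> `|g x - g y| <= k.+1%:R^-1].
have OO k : open (O k) /\ dense (O k).
  split.
    rewrite openE => t [t0|[r r0 H]].
      have : nbhs t [set x : R | x < 0] by exact: lt_nbhsl.
      by apply: filterS => x x0; left.
    exists (r / 2); first by rewrite /= divr_gt0.
    move=> x tx; right; exists (r / 2); first by rewrite divr_gt0.
    by move=> y z xy xz; apply: H; rewrite (splitr r) -(subrKA x) (le_lt_trans (ler_normD _ _))// ltrD.
  move=> U [t Ut] Uo.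
  have [t0|t0] := ltP t 0; first by exists t; split=> //; left.
  have : nbhs t U by rewrite openE in Uo; exact: Uo.
  case=> e /= e0 teU.
  have k0 : 0 < (k.+1%:R^-1 / 2 : R) by rewrite divr_gt0.
  have /cvgrPdist_le /(_ _ k0)/near0_rightP[r r0 H] := gr _ t0.
  pose m := Num.min e r.
  have m0 : 0 < m by rewrite lt_min e0.
  have [me mr] : m <= e /\ m <= r by rewrite !ge_min !lexx orbT.
  have Hr (x : R) : `|t + m / 2 - x| < m / 2 -> `|g t - g x| <= k.+1%:R^-1 / 2.
    rewrite ltr_distlC => /andP[x1 x2].
    have := H (x - t); rewrite subrKC; apply.
    rewrite addrK in x1; rewrite -addrA -splitr in x2.
    by rewrite subr_gt0 x1 ltrBlDl (lt_le_trans x2)// lerD2l.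
  exists (t + m / 2); split.
    apply: teU; rewrite /ball/= opprD addNKr normrN gtr0_norm ?divr_gt0//.
    by rewrite ltr_pdivrMr// (le_lt_trans me)// ltr_pMr// ltr1n.
  right; exists (m / 2); first by rewrite divr_gt0.
  move=> x y /Hr Hx /Hr Hy.
  rewrite -(subrKA (g t)) (le_trans (ler_normD _ _))// (splitr k.+1%:R^-1).
  by rewrite lerD// distrC.
have := Baire OO; move=> /(_ (ball (d / 2 : R^o) (d / 2))).
case; first by exists (d / 2); rewrite /ball/= subrr normr0 divr_gt0.
  exact: (@ball_open R R^o).
move=> t [dt Ot]; move: dt; rewrite /ball/= ltr_distlC subrr -splitr => td.
exists t => // e e0.
near \oo => k.
case: (Ot k I) => [t0|[r r0 H]].
  by move: td => /andP[]; rewrite ltNge (ltW t0).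
apply/near0_rightP; exists r => // h /andP[h0 hr].
apply: (le_trans (H _ _ _ _)); first by rewrite subrr normr0.
  by rewrite subKr gtr0_norm.
by apply/ltW; near: k; exact: (near_infty_natSinv_lt (PosNum e0)).
Unshelve. all: by end_near. Qed.

(** * Strongly continuous semigroups *)

Section Semigroup.
Context (R : realType) (X : normedModType R) (T : R -> X -> X).
Hypothesis sgT : C0_semigroup setT T.

Lemma semigroupB t x y : 0 <= t -> T t (x - y) = T t x - T t y.
Proof.
by move=> t0; rewrite addrC -scaleN1r (C0_linear sgT)// scaleN1r addrC.
Qed.

Lemma semigroupZ t a x : 0 <= t -> T t (a *: x) = a *: T t x.
Proof.
move=> t0; have := @C0_linear _ _ _ _ sgT t a x 0 t0 I I; rewrite addr0 => ->.
by have := semigroupB 0 0 t0; rewrite !subrr => ->; rewrite addr0.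
Qed.

Lemma semigroup_bounded t : 0 <= t ->
  exists2 M, 0 < M & forall x, `|T t x| <= M * `|x|.
Proof.
move=> t0; have [M MP] := C0_bounded sgT t0.
exists (`|M| + 1) => [|x]; first by rewrite ltr_wpDl.
rewrite (le_trans (MP x I))// ler_wpM2r// (le_trans (ler_norm M))// lerDl//.
Qed.

Lemma semigroup_right_continuous t x : 0 <= t ->
  T (t + h) x @[h --> 0^'+] --> T t x.
Proof.
move=> t0; have [M M0 MP] := semigroup_bounded t0.
apply/cvgrPdist_le => e e0.
have eM : 0 < e / M by rewrite divr_gt0.
have /cvgrPdist_le/(_ _ eM) := C0_continuous sgT (I : setT x).
apply: filterS2 (nbhs_right_gt 0) => h h0 H; have h0' := ltW h0.
rewrite (C0_D sgT)// -semigroupB// (le_trans (MP _))//.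
by rewrite -ler_pdivlMl// mulrC.
Qed.

(** The usual argument bounds [T] uniformly near time [0] by the uniform
    boundedness principle, which requires completeness. Here the orbit is left
    continuous at some [s] with [0 < s < t], and the single bounded operator
    [T (t - s)] transports this from [s] to [t]. *)
Lemma semigroup_left_continuous t x : 0 < t ->
  left_continuous_at (fun s => T s x) t.
Proof.
move=> t0; have [|s /andP[s0 st] gs] := @exists_left_continuous_at R X (T^~ x) t t0.
  by move=> s s0; exact: semigroup_right_continuous.
have ts0 : 0 <= t - s by rewrite subr_ge0 ltW.
have [M M0 MP] := semigroup_bounded ts0.
move=> e e0; have eM : 0 < e / M by rewrite divr_gt0.
apply: filterS2 (gs _ eM) (nbhs_right_lt s0) => h H hs.
have -> : T t x = T (t - s) (T s x) by rewrite -(C0_D sgT)// ?subrK// ltW.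
have -> : T (t - h) x = T (t - s) (T (s - h) x).
  by rewrite -(C0_D sgT)// ?subrKA// subr_ge0 ltW.
by rewrite -semigroupB// (le_trans (MP _))// -ler_pdivlMl// mulrC.
Qed.

(** [T t] is bounded and commutes with the difference quotients at [0]. *)
Lemma semigroup_generator_stable t x y : 0 <= t ->
  semigroup_generator setT T (x, y) ->
  semigroup_generator setT T (T t x, T t y).
Proof.
move=> t0 [_ /= Txy]; split=> //=.
have [M M0 MP] := semigroup_bounded t0.
apply/cvgrPdist_le => e e0.
have eM : 0 < e / M by rewrite divr_gt0.
have /cvgrPdist_le/(_ _ eM) := Txy.
apply: filterS2 (nbhs_right_gt 0) => h h0 H; have h0' := ltW h0.
rewrite /= -(C0_D sgT)// (addrC h) (C0_D sgT)//.
rewrite -semigroupB// -semigroupZ// -semigroupB// (le_trans (MP _))//.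
by rewrite -ler_pdivlMl// mulrC.
Qed.

Lemma semigroup_right_derivative t x y : 0 <= t ->
  semigroup_generator setT T (x, y) -> forall e, 0 < e ->
  \forall h \near 0^'+, `|T (t + h) x - T t x - h *: T t y| <= e * h.
Proof.
move=> t0 /(semigroup_generator_stable t0)[_ /= H] e e0.
have /cvgrPdist_le/(_ _ e0) := H.
apply: filterS2 (nbhs_right_gt 0) => h h0; have h0' := ltW h0.
rewrite -(C0_D sgT)// (addrC h) distrC => Hh.
rewrite -[X in X - _](scalerKV (lt0r_neq0 h0)) -scalerBr normrZ gtr0_norm//.
by rewrite mulrC ler_pM2r.
Qed.

End Semigroup.

(** * The closed negative half-line *)

Section HalfLine.
Context (R : realType) (V : normedModType R).
Implicit Types (x y : half_line R) (phi psi : half_line R -> V).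

Lemma half_line_le0 x : \val x <= 0.
Proof. by case: x => x /=; rewrite inE /= in_itv. Qed.

Lemma clamp_subproof (x : R) : Num.min x 0 \in (`]-oo, (0 : R)]%classic : set R).
Proof. by rewrite inE /= in_itv /= ge_min lexx orbT. Qed.

(** Functions on the half-line are evaluated at real numbers through this
    retraction, so that calculus can be done with real arguments. *)
Definition clamp (x : R) : half_line R := exist _ (Num.min x 0) (clamp_subproof x).

Lemma val_clamp (x : R) : x <= 0 -> \val (clamp x) = x.
Proof. by move=> x0; rewrite /= min_l. Qed.

Lemma clampK x : clamp (\val x) = x.
Proof. by apply: val_inj; rewrite val_clamp// half_line_le0. Qed.

Lemma clamp0 : clamp 0 = half_line0 R.
Proof. by apply: val_inj; rewrite val_clamp. Qed.

Lemma nbhs_half_lineP x (P : set (half_line R)) :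
  nbhs x P <-> exists2 d, 0 < d & forall y, `|\val x - \val y| < d -> P y.
Proof.
by split=> [/nbhs_ballP[d d0 H]|[d d0 H]]; [|apply/nbhs_ballP]; exists d.
Qed.

Lemma continuous_half_lineP phi : continuous phi <->
  forall x e, 0 < e -> exists2 d, 0 < d &
    forall y, `|\val x - \val y| < d -> `|phi x - phi y| <= e.
Proof.
split=> H x.
  move=> e e0; have /cvgrPdist_le/(_ _ e0)/nbhs_half_lineP[d d0 Hd] := H x.
  by exists d.
apply/(@cvgrPdist_le _ _ _ (nbhs x) _) => e e0; apply/nbhs_half_lineP; exact: H.
Qed.

Lemma unif_continuous_half_lineP phi : unif_continuous phi <->
  forall e, 0 < e -> exists2 d, 0 < d &
    forall x y, `|\val x - \val y| < d -> `|phi x - phi y| <= e.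
Proof.
split=> [/unif_continuousP H e e0|H].
  have [d d0 Hd] := H _ e0; exists d => // x y xy; apply/ltW.
  by have := Hd (x, y) xy; rewrite -ball_normE.
apply/unif_continuousP => e e0.
have e2 : 0 < e / 2 by rewrite divr_gt0.
have [d d0 Hd] := H _ e2.
exists d => // -[x y] xy; rewrite -ball_normE /ball_ /=.
by rewrite (le_lt_trans (Hd _ _ xy))// ltr_pdivrMr// ltr_pMr// ltr1n.
Qed.

Lemma half_line_derivativeP phi psi : half_line_derivative phi psi <->
  forall x e, 0 < e -> exists2 d, 0 < d & forall y, `|\val x - \val y| < d ->
    `|phi y - phi x - (\val y - \val x) *: psi x| <= e * `|\val x - \val y|.
Proof.
have Hxy x y e : x != y -> (`|psi x - (\val y - \val x)^-1 *: (phi y - phi x)| <= e) =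
   (`|phi y - phi x - (\val y - \val x) *: psi x| <= e * `|\val x - \val y|).
  move=> xy; have yx : \val y - \val x != 0.
    by rewrite subr_eq0 eq_sym; apply: contra_neq xy => /val_inj.
  rewrite -[phi y - phi x in RHS](scalerKV yx) -scalerBr normrZ mulrC.
  by rewrite (distrC (\val x)) ler_pM2r ?normr_gt0// distrC.
split=> H x.
  move=> e e0; have /cvgrPdist_le/(_ _ e0)/nbhs_half_lineP[d d0 Hd] := H x.
  exists d => // y xy; have [->|yx] := eqVneq x y.
    by rewrite !subrr scale0r subr0 !normr0 mulr0.
  by rewrite -Hxy//; apply: Hd => //; rewrite eq_sym.
apply/(@cvgrPdist_le _ _ _ (dnbhs x) _) => e e0; apply/nbhs_half_lineP.
by have [d d0 Hd] := H x e e0; exists d => // y /Hd xy yx; rewrite Hxy// eq_sym.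
Qed.

End HalfLine.

(** * The flow of a delay equation *)

Section BUCFacts.
Context (R : realType) (V : normedModType R) (eta : R).
Local Notation BUC := (BUC V eta).
Implicit Types (phi psi : BUC) (x y : half_line R).

Lemma clamp_lipschitz (s t : R) : `|\val (clamp s) - \val (clamp t)| <= `|s - t|.
Proof.
wlog st : s t / s <= t => [H|].
  by have [/H//|/ltW/H] := leP s t; rewrite distrC (distrC t).
rewrite distrC (distrC s) /= (ger0_norm (_ : 0 <= t - s)) ?subr_ge0//.
have [t0|t0] := leP t 0.
  by rewrite min_l ?(le_trans st)// ger0_norm// subr_ge0.
have [s0|s0] := leP s 0.
  by rewrite sub0r ger0_norm ?oppr_ge0// lerDr ltW.
by rewrite subrr normr0 subr_ge0.
Qed.

Lemma BUCP phi : [/\ continuous phi, bounded_fun (weighted eta phi)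
                & unif_continuous (weighted eta phi)].
Proof. by have := valP phi; rewrite inE. Qed.

Lemma BUCB phi psi x : (phi - psi) x = phi x - psi x. Proof. by []. Qed.
Lemma BUCD phi psi x : (phi + psi) x = phi x + psi x. Proof. by []. Qed.
Lemma BUCZ a phi x : (a *: phi) x = a *: phi x. Proof. by []. Qed.

Lemma BUC_eval_le phi x : `|phi x| <= expR (- (eta * \val x)) * `|phi|.
Proof.
rewrite expRN ler_pdivlMl ?expR_gt0//; exact: BUC_norm_ub.
Qed.

Lemma BUC_eval0_le phi : `|phi (half_line0 R)| <= `|phi|.
Proof. by have := BUC_eval_le phi (half_line0 R); rewrite /= mulr0 oppr0 expR0 mul1r. Qed.

Lemma continuous_clamp (phi : half_line R -> V) (s e : R) : continuous phi -> 0 < e ->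
  exists2 d, 0 < d & forall t, `|s - t| < d -> `|phi (clamp s) - phi (clamp t)| <= e.
Proof.
move=> /continuous_half_lineP phic e0; have [d d0 H] := phic (clamp s) e e0.
by exists d => // t st; apply: H; exact: le_lt_trans (clamp_lipschitz _ _) st.
Qed.

Lemma near_clampD phi (s e : R) : 0 < e ->
  \forall h \near 0^'+, `|phi (clamp s) - phi (clamp (s + h))| <= e.
Proof.
move=> e0; have [phic _ _] := BUCP phi; have [d d0 H] := continuous_clamp s phic e0.
apply/near0_rightP; exists d => // h /andP[h0 hd].
by apply: H; rewrite opprD addNKr normrN gtr0_norm.
Qed.

Lemma near_clampB phi (s e : R) : 0 < e ->
  \forall h \near 0^'+, `|phi (clamp s) - phi (clamp (s - h))| <= e.
Proof.
move=> e0; have [phic _ _] := BUCP phi; have [d d0 H] := continuous_clamp s phic e0.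
apply/near0_rightP; exists d => // h /andP[h0 hd].
by apply: H; rewrite subKr gtr0_norm.
Qed.

Lemma BUC_derivative_near phi psi (s e : R) : s <= 0 -> 0 < e ->
  BUC_derivative phi psi -> \forall h \near 0^'+,
  `|phi (clamp (s - h)) - phi (clamp s) + h *: psi (clamp s)| <= e * h.
Proof.
move=> s0 e0 /half_line_derivativeP/(_ (clamp s) e e0)[d d0 H].
apply/near0_rightP; exists d => // h /andP[h0 hd].
have vsh : \val (clamp (s - h)) = s - h by rewrite val_clamp// lerBlDr ler_wpDr// ltW.
have := H (clamp (s - h)); rewrite vsh val_clamp// subKr gtr0_norm// => /(_ hd).
by rewrite (_ : s - h - s = - h) ?scaleNr ?opprK// addrAC subrr add0r.
Qed.

End BUCFacts.

Section DelayFlow.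
Context (R : realType) (V : normedModType R) (eta : R) (eta0 : 0 < eta).
Local Notation BUC := (BUC V eta).
Variables (L : BUC -> V) (U : R -> BUC -> BUC).
Hypothesis sgU : C0_semigroup setT U.
Hypothesis genU : forall phi psi, semigroup_generator setT U (phi, psi) ->
  BUC_derivative phi psi /\ psi (half_line0 R) = L phi.
Variable M : R.
Hypothesis M0 : 0 <= M.
Hypothesis LM : forall phi, `|L phi| <= M * `|phi|.

Section Domain.
Variables (phi psi : BUC).
Hypothesis phipsi : semigroup_generator setT U (phi, psi).

(** In the domain, the time derivative of [U t phi] is its space derivative,
    so [r |-> U r phi (p + t - r)] has right derivative zero. It is left
    continuous since the orbit is, hence constant by [mean_value_right]. *)
Lemma characteristics_constant (s t p : R) : 0 <= s <= t -> p <= 0 ->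
  p + t - s <= 0 -> U t phi (clamp p) = U s phi (clamp (p + t - s)).
Proof.
move=> /andP[s0 st] p0 ps0.
pose g r : V := U r phi (clamp (p + t - r)).
(* All the points visited lie between [p] and [0], and there the weight turns
   a norm in BUC into a value with the constant [E]. *)
pose E := expR (- (eta * p)).
have E0 : 0 < E by rewrite expR_gt0.
have evalE (chi : BUC) q : p <= q <= 0 -> `|chi (clamp q)| <= E * `|chi|.
  move=> /andP[pq q0]; rewrite (le_trans (BUC_eval_le _ _))// ler_wpM2r//.
  by rewrite ler_expR lerN2 val_clamp// ler_wpM2l// ltW.
suff : `|g t - g s| <= 0 * (t - s).
  by rewrite mul0r normr_le0 subr_eq0 /g addrK => /eqP.
apply: mean_value_right => //.
  move=> r /andP[sr rt] e e0.
  have r0 : 0 < r by exact: le_lt_trans sr.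
  have e1 : 0 < e / 2 by rewrite divr_gt0.
  have e2 : 0 < e / 2 / E by rewrite divr_gt0.
  have c1 := near_clampD (U r phi) (p + t - r) e1.
  have c2 := semigroup_left_continuous sgU phi r0 e2.
  have rs : 0 < r - s by rewrite subr_gt0.
  near=> h.
  have h0 : 0 < h by near: h; exact: nbhs_right_gt.
  have hrs : h < r - s by near: h; exact: nbhs_right_lt.
  have -> : g r - g (r - h) = (g r - U r phi (clamp (p + t - r + h)))
      + (U r phi - U (r - h) phi) (clamp (p + t - r + h)).
    by rewrite BUCB addrA subrK /g opprB addrA (addrAC _ h).
  rewrite (le_trans (ler_normD _ _))// (splitr e) lerD//.
    by near: h; exact: c1.
  rewrite (le_trans (evalE _ _ _))//.
    by apply/andP; split; lra.
  by rewrite -ler_pdivlMl// mulrC; near: h.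
move=> r /andP[sr rt] e e0.
have r0 : 0 <= r by exact: le_trans sr.
have [rder _] := genU (semigroup_generator_stable sgU r0 phipsi).
have e1 : 0 < e / (E + 2) by rewrite divr_gt0// addr_gt0.
pose q := p + t - r; have q0 : q <= 0 by rewrite (le_trans _ ps0)// lerD2l lerN2.
have c1 := near_clampB (U r psi) q e1.
have c2 := semigroup_right_derivative sgU r0 phipsi e1.
have c3 := BUC_derivative_near q0 e1 rder.
have tr : 0 < t - r by rewrite subr_gt0.
near=> h.
have h0 : 0 < h by near: h; exact: nbhs_right_gt.
have htr : h < t - r by near: h; exact: nbhs_right_lt.
have qh : p + t - (r + h) = q - h by rewrite opprD addrA.
(* The increment of the orbit beyond its linear part, the variation of the
   derivative in space, and the increment in space beyond its linear part are
   all negligible against [h]; their linear parts cancel. *)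
have -> : g (r + h) - g r = (U (r + h) phi - U r phi - h *: U r psi) (clamp (q - h))
   + h *: (U r psi (clamp (q - h)) - U r psi (clamp q))
   + (U r phi (clamp (q - h)) - U r phi (clamp q) + h *: U r psi (clamp q)).
  rewrite !BUCB BUCZ /g qh -/q scalerBr.
  by rewrite (subrKA (h *: _)) [X in _ = _ + X]addrC addrA subrK subrKA.
have -> : (0 + e) * h = E * (e / (E + 2) * h) + h * (e / (E + 2)) + e / (E + 2) * h.
  have E2 : E + 2 != 0 by rewrite gt_eqF//; lra.
  by field.
rewrite (le_trans (ler_normD _ _))// lerD//; last by near: h.
rewrite (le_trans (ler_normD _ _))// lerD//.
  rewrite (le_trans (evalE _ _ _))//.
    by rewrite /q; apply/andP; split; lra.
  by rewrite ler_pM2l//; near: h.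
rewrite normrZ gtr0_norm// ler_pM2l// distrC.
by near: h; exact: c1.
Unshelve. all: by end_near. Qed.

Lemma domain_flow_interior (t p : R) : 0 <= t -> p + t <= 0 ->
  U t phi (clamp p) = phi (clamp (p + t)).
Proof.
move=> t0 pt; have := @characteristics_constant 0 t p; rewrite lexx t0 subr0 => ->//.
  by rewrite (C0_0 sgU).
by rewrite (le_trans _ pt)// lerDl.
Qed.

Let z s := U s phi (half_line0 R).

Lemma domain_flow_boundary (t p : R) : - t <= p <= 0 -> U t phi (clamp p) = z (p + t).
Proof.
move=> /andP[tp p0]; have pt0 : 0 <= p + t by lra.
rewrite (@characteristics_constant (p + t)) ?subrr ?clamp0//; lra.
Qed.

(** The graph of [U t phi] consists of the translate of [phi], whose weighted
    norm decreases, and of the boundary values since time [0]. *)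
Lemma domain_flow_norm_le (t K : R) : 0 <= t -> `|phi| <= K ->
  (forall s, 0 <= s <= t -> `|z s| <= K) -> `|U t phi| <= K.
Proof.
move=> t0 phiK zK; apply: BUC_norm_le => x; rewrite -(clampK x).
have x0 := half_line_le0 x; set p := \val x in x0 *.
have K0 : 0 <= K by exact: le_trans phiK.
have [pt|pt] := leP (p + t) 0.
  rewrite domain_flow_interior// val_clamp//.
  rewrite (le_trans (ler_wpM2l (expR_ge0 _) (BUC_eval_le _ _)))// mulrA -expRD.
  rewrite val_clamp// mulrDr opprD addNKr (le_trans _ phiK)// ler_piMl//.
  by rewrite -expR0 ler_expR oppr_le0 mulr_ge0// ltW.
rewrite domain_flow_boundary; last by apply/andP; split; lra.
rewrite val_clamp// (le_trans (ler_wpM2l (expR_ge0 _) (zK _ _)))//.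
  by apply/andP; split; lra.
by rewrite ler_piMl// -expR0 ler_expR mulr_ge0_le0// ltW.
Qed.

Let zdist (r s : R) : `|z r - z s| <= `|U r phi - U s phi|.
Proof. exact: (BUC_eval0_le (U r phi - U s phi)). Qed.

Let z_left_continuous (s : R) : 0 < s -> left_continuous_at z s.
Proof.
move=> s0 e e0; apply: filterS (semigroup_left_continuous sgU phi s0 e0).
by move=> h; exact: le_trans (zdist _ _).
Qed.

Let z_right_derivative (s e : R) : 0 <= s -> 0 < e -> \forall h \near 0^'+,
  `|z (s + h) - z s| <= (`|L (U s phi)| + e) * h.
Proof.
move=> s0 e0; have [_ <-] := genU (semigroup_generator_stable sgU s0 phipsi).
have := semigroup_right_derivative sgU s0 phipsi e0.
apply: filterS2 (nbhs_right_gt 0) => h h0 H.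
rewrite -[X in `|X|](subrK (h *: U s psi (half_line0 R))).
rewrite (le_trans (ler_normD _ _))// normrZ gtr0_norm// addrC mulrDl mulrC lerD//.
exact: le_trans (BUC_eval0_le _) H.
Qed.

(** Gronwall's inequality by real induction: if the boundary values obey the
    bound [k] up to time [x], so does the norm of the state, hence the
    boundary value has slope at most [M * k x], strictly less than that of
    [k]. *)
Lemma domain_flow_growth (t K : R) : 0 < K -> `|phi| <= K -> 0 <= t ->
  `|U t phi| <= K * expR ((M + 1) * t).
Proof.
move=> K0 phiK t0.
pose k s := K * expR ((M + 1) * s).
have k_mono s r : s <= r -> k s <= k r.
  by move=> sr; rewrite /k ler_pM2l// ler_expR ler_wpM2l// ler_wpDr.
have k0 s : 0 < k s by rewrite mulr_gt0// expR_gt0.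
have Kk s : 0 <= s -> K <= k s.
  by move=> /k_mono; apply: le_trans; rewrite /k mulr0 expR0 mulr1.
suff H s : 0 <= s <= t -> `|z s| <= k s.
  apply: domain_flow_norm_le => //; first by rewrite (le_trans phiK)// Kk.
  move=> s /andP[s0 st]; rewrite (le_trans (H _ _))//; first by rewrite s0.
  exact: k_mono.
move: s; apply: (@real_induction R (fun s => `|z s| <= k s)) => x /andP[x0 xt] IH.
  move: x0; rewrite le_eqVlt => /orP[/eqP <-|x0].
    rewrite (le_trans (BUC_eval0_le _))// (C0_0 sgU)// (le_trans phiK)//.
    exact: Kk.
  apply/ler_addgt0Pr => e e0; have := z_left_continuous x0 e0.
  move=> /near0_rightP[d d0 H].
  pose h := Num.min d x / 2.
  have m0 : 0 < Num.min d x by rewrite lt_min d0.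
  have hm : h < Num.min d x by rewrite ltr_pdivrMr// ltr_pMr// ltr1n.
  have h0 : 0 < h by rewrite divr_gt0.
  move: hm; rewrite lt_min => /andP[hd hx].
  rewrite -[z x](subrK (z (x - h))) (le_trans (ler_normD _ _))// addrC lerD//.
    rewrite (le_trans (IH _ _))//; last by rewrite k_mono// gerBl ltW.
    by apply/andP; split; lra.
  by apply: H; rewrite h0.
have Ux : `|U x phi| <= k x.
  apply: domain_flow_norm_le => //; first by rewrite (le_trans phiK)// Kk.
  move=> s /andP[s0 sx]; rewrite (le_trans (IH _ _)) ?k_mono//.
  by rewrite s0.
have zx : `|z x| <= k x by apply: IH; rewrite x0 lexx.
apply: filterS2 (nbhs_right_gt 0) (z_right_derivative x0 (k0 x)) => h h0 H.
rewrite -[z _](subrK (z x)) (le_trans (ler_normD _ _))// addrC.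
rewrite (le_trans (lerD zx H))// /k mulrDr expRD mulrA -/(k x).
(* The rate [M + 1] leaves room for the error [k x * h] of the right
   derivative. *)
rewrite (@le_trans _ _ (k x * (1 + (M + 1) * h)))//; last first.
  by rewrite ler_pM2l// expR_ge1Dx.
rewrite mulrDr mulr1 lerD2l mulrA ler_pM2r// mulrDr mulr1 lerD2r mulrC.
by rewrite (le_trans (LM _))// ler_wpM2l.
Qed.

(** The boundary values have right derivative [L (U s phi)], which
    [domain_flow_growth] bounds. The constant depends on [phi] only through
    [K], so it survives a passage to the limit. *)
Lemma domain_flow_boundary_lipschitz (t K p q : R) : 0 < K -> `|phi| <= K ->
  - t <= p <= 0 -> - t <= q <= 0 ->
  `|U t phi (clamp p) - U t phi (clamp q)| <= M * (K * expR ((M + 1) * t)) * `|p - q|.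
Proof.
move=> K0 phiK; wlog qp : p q / q <= p => [H|] pt qt.
  have [qp|/ltW pq] := leP q p; first exact: H.
  by rewrite distrC (distrC p); exact: H.
rewrite !domain_flow_boundary// (ger0_norm (_ : 0 <= p - q)) ?subr_ge0//.
move: pt qt => /andP[tp p0] /andP[tq q0].
rewrite (_ : p - q = (p + t) - (q + t)); last by lra.
apply: (@mean_value_right R V z (q + t) (p + t)); first lra.
- by rewrite mulr_ge0// mulr_ge0 ?expR_ge0// ltW.
- by move=> x /andP[qx _]; apply: z_left_continuous; lra.
move=> x /andP[qx xp] e e0; have x0 : 0 <= x by lra.
apply: filterS2 (nbhs_right_gt 0) (z_right_derivative x0 e0) => h h0 H.
rewrite (le_trans H)// ler_pM2r// lerD2r (le_trans (LM _))// ler_wpM2l//.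
rewrite (le_trans (domain_flow_growth K0 phiK x0))// ler_pM2l// ler_expR ler_wpM2l//.
  by rewrite ler_wpDr.
lra.
Qed.

End Domain.
Hypothesis domain_dense : forall phi e, 0 < e ->
  exists f g, semigroup_generator setT U (f, g) /\ `|f - phi| <= e.

Let le_approx (a b K : R) :
  (forall e, 0 < e -> e <= 1 -> a <= b + K * e) -> a <= b.
Proof.
move=> H; apply/ler_addgt0Pr => e e0.
have K0 : 0 < `|K| + 1 by rewrite ltr_wpDl.
have m0 : 0 < Num.min (e / (`|K| + 1)) 1 by rewrite lt_min divr_gt0/=.
have := H _ m0; rewrite ge_min lexx orbT => /(_ isT)/le_trans; apply.
rewrite lerD2l (@le_trans _ _ ((`|K| + 1) * Num.min (e / (`|K| + 1)) 1))//.
  by rewrite ler_pM2r// (le_trans (ler_norm K))// lerDl.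
by rewrite mulrC -ler_pdivlMr// ge_min lexx.
Qed.

(** Both sides are continuous in [phi], and they agree on the domain of the
    generator. *)
Lemma flow_interior phi (t p : R) : 0 <= t -> p + t <= 0 ->
  U t phi (clamp p) = phi (clamp (p + t)).
Proof.
move=> t0 pt; have [K K0 KP] := semigroup_bounded sgU t0.
have p0 : p <= 0 by lra.
pose E := expR (- (eta * p)); pose E' := expR (- (eta * (p + t))).
apply/eqP; rewrite -subr_eq0 -normr_le0; apply: (@le_approx _ _ (E * K + E')).
move=> e e0 _; have [f [g [fg fphi]]] := domain_dense phi e0.
rewrite add0r -[U t phi (clamp p)](subrK (f (clamp (p + t)))) -addrA.
rewrite (le_trans (ler_normD _ _))// mulrDl lerD//.
  rewrite -(domain_flow_interior fg t0 pt) -BUCB -semigroupB//.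
  rewrite (le_trans (BUC_eval_le _ _))// val_clamp// -mulrA ler_pM2l ?expR_gt0//.
  by rewrite (le_trans (KP _))// ler_pM2l// distrC.
rewrite -BUCB (le_trans (BUC_eval_le _ _))// val_clamp// ler_pM2l ?expR_gt0//.
Qed.

(** Elements of the unit ball are limits of elements of the domain of norm at
    most [2], which share one Lipschitz constant. *)
Lemma flow_boundary_lipschitz (t : R) : 0 <= t -> exists2 C, 0 <= C & forall phi p q,
  `|phi| <= 1 -> - t <= p <= 0 -> - t <= q <= 0 ->
  `|U t phi (clamp p) - U t phi (clamp q)| <= C * `|p - q|.
Proof.
move=> t0; have [K K0 KP] := semigroup_bounded sgU t0.
exists (M * (2 * expR ((M + 1) * t))).
  by rewrite mulr_ge0// mulr_ge0// expR_ge0.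
move=> phi p q phi1 pt qt.
pose E := expR (eta * t).
have evalE psi s : - t <= s <= 0 -> `|U t psi (clamp s)| <= E * K * `|psi|.
  move=> /andP[ts s0]; rewrite (le_trans (BUC_eval_le _ _))// -mulrA.
  rewrite ler_pM ?expR_ge0// val_clamp// ler_expR -mulrN ler_pM2l//; lra.
apply: (@le_approx _ _ (2 * (E * K))) => e e0 e1.
have [f [g [fg fphi]]] := domain_dense phi e0.
have EKe : 0 <= E * K by rewrite mulr_ge0 ?expR_ge0// ltW.
have -> : U t phi (clamp p) - U t phi (clamp q) =
    (U t f (clamp p) - U t f (clamp q)) - U t (f - phi) (clamp p) + U t (f - phi) (clamp q).
  rewrite !semigroupB// !BUCB !opprB.
  set a := U t f _; set b := U t f _; set c := U t phi _; set d := U t phi _.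
  by rewrite [X in _ = X + _]addrC !subrKA.
rewrite [leRHS](_ : _ = M * (2 * expR ((M + 1) * t)) * `|p - q| + E * K * e + E * K * e);
  last by ring.
rewrite (le_trans (ler_normD _ _))// lerD//; last first.
  by rewrite (le_trans (evalE _ _ _))// ler_wpM2l.
rewrite (le_trans (ler_normB _ _))// lerD//; last first.
  by rewrite (le_trans (evalE _ _ _))// ler_wpM2l.
apply: (@domain_flow_boundary_lipschitz f g fg t 2 p q) => //.
rewrite -[f](subrK phi) (le_trans (ler_normD _ _))//.
by rewrite (le_trans (lerD fphi phi1))//; lra.
Qed.

End DelayFlow.

(** * Differentiation on the half-line and membership in BUC *)

Lemma is_derive_estimate (R : realType) (u : R -> R) (x du e : R) :
  is_derive x 1 u du -> 0 < e ->
  exists2 d, 0 < d & forall y, `|x - y| < d ->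
    `|u y - u x - (y - x) * du| <= e * `|x - y|.
Proof.
move=> [du1 du2] e0.
have /cvgrPdist_le/(_ _ e0)[d /= d0 H] : h^-1 *: (u (h *: 1 + x) - u x) @[h --> 0^'] --> du.
  by rewrite -du2; exact: du1.
exists d => // y xy; have [->|yx] := eqVneq y x.
  by rewrite !subrr mul0r subr0 !normr0 mulr0.
have yx0 : y - x != 0 by rewrite subr_eq0.
have := H (y - x); rewrite /= sub0r normrN distrC => /(_ xy yx0).
rewrite /= scaler1 subrK => H1.
rewrite -[u y - u x](scalerKV yx0) -scalerBr normrM mulrC.
by rewrite (distrC x) ler_pM2r ?normr_gt0// distrC.
Qed.

Section Criteria.
Context (R : realType) (V : normedModType R) (eta : R) (eta0 : 0 < eta).
Local Notation BUC := (BUC V eta).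
Implicit Types (f g : half_line R -> V) (phi psi : BUC) (x y : half_line R).

(** [f] is its weighted version divided by the weight, so uniform continuity
    of the latter makes [f] continuous. *)
Lemma is_BUC_weighted (B : R) f : (forall x, `|weighted eta f x| <= B) ->
  unif_continuous (weighted eta f) -> is_BUC eta f.
Proof.
move=> fB fu; split => //; last first.
  exists B; split; first exact: num_real.
  by move=> r /ltW Br x _; exact: le_trans Br.
have wc : continuous (weighted eta f).
  move/unif_continuous_half_lineP : fu => fu; apply/continuous_half_lineP.
  by move=> x e /fu[d d0 H]; exists d => // y /H.
have ec : continuous (fun s : R => expR (- (eta * s))).
  move=> s; apply: (@continuous_comp _ _ _ (fun s => - (eta * s)) expR).
    by apply: cvgN; apply: cvgMl_tmp; exact: cvg_id.
  exact: continuous_expR.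
have -> : f = fun x => expR (- (eta * \val x)) *: weighted eta f x.
  by apply/funext => x; rewrite /weighted scalerA -expRD addNr expR0 scale1r.
move=> x; apply: (@cvgZ _ _ _ (nbhs x) _ (fun x => expR (- (eta * \val x)))).
  apply: (@cvg_comp _ _ _ (fun x : half_line R => \val x : R) (fun s : R => expR (- (eta * s)))
    (nbhs x) (nbhs (\val x))).
    exact: initial_continuous.
  exact: ec.
exact: wc.
Qed.

(** A derivative in the sense of the half-line yields slopes on both sides of
    every negative point, in particular those that [mean_value_right] needs.
    *)
Lemma half_line_mean_value f g (a b K : R) : half_line_derivative f g ->
  a <= b -> b <= 0 -> 0 <= K -> (forall s, a <= s <= b -> `|g (clamp s)| <= K) ->
  `|f (clamp b) - f (clamp a)| <= K * (b - a).
Proof.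
move=> /half_line_derivativeP fg ab b0 K0 gK.
have slope s e : a <= s <= b -> 0 < e -> exists2 d, 0 < d & forall t, t <= 0 ->
    `|s - t| < d -> `|f (clamp t) - f (clamp s)| <= (K + e) * `|s - t|.
  move=> /andP[as_ sb] e0; have s0 : s <= 0 by exact: le_trans b0.
  have [d d0 H] := fg (clamp s) e e0; exists d => // t t0 st.
  have := H (clamp t); rewrite !val_clamp// => /(_ st) {}H.
  rewrite -[X in `|X|](subrK ((t - s) *: g (clamp s))) (le_trans (ler_normD _ _))//.
  rewrite addrC mulrDl lerD// normrZ mulrC (distrC t) ler_wpM2r//.
  by apply: gK; rewrite as_.
apply: (@mean_value_right R V (f \o @clamp R)) => // [x /andP[ax xb]|x /andP[ax xb]] e e0.
  have [|d d0 H] := slope x 1 _ ltr01; first by rewrite ltW.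
  have K1 : 0 < K + 1 by rewrite ltr_wpDl.
  have x0 : x <= 0 by exact: le_trans b0.
  near=> h; have h0 : 0 < h by near: h; exact: nbhs_right_gt.
  rewrite distrC (le_trans (H (x - h) _ _))//.
  - by lra.
  - by rewrite subKr gtr0_norm//; near: h; exact: nbhs_right_lt.
  rewrite subKr gtr0_norm// -ler_pdivlMl// mulrC; near: h; apply: nbhs_right_le.
  by rewrite divr_gt0.
have [|d d0 H] := slope x e _ e0; first by rewrite ax ltW.
have x0 : x < 0 by exact: lt_le_trans b0.
near=> h; have h0 : 0 < h by near: h; exact: nbhs_right_gt.
have hx : h < - x by near: h; apply: nbhs_right_lt; rewrite oppr_gt0.
rewrite (le_trans (H (x + h) _ _))//=; first by lra.
  by rewrite opprD addNKr normrN gtr0_norm//; near: h; exact: nbhs_right_lt.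
by rewrite opprD addNKr normrN gtr0_norm.
Unshelve. all: by end_near. Qed.

Lemma half_line_derivativeD f1 g1 f2 g2 : half_line_derivative f1 g1 ->
  half_line_derivative f2 g2 -> half_line_derivative (f1 \+ f2) (g1 \+ g2).
Proof.
move=> /half_line_derivativeP H1 /half_line_derivativeP H2.
apply/half_line_derivativeP => x e e0; have e2 : 0 < e / 2 by rewrite divr_gt0.
have [d1 d10 {}H1] := H1 x _ e2; have [d2 d20 {}H2] := H2 x _ e2.
exists (Num.min d1 d2) => [|y]; first by rewrite lt_min d10.
rewrite lt_min => /andP[/H1 {}H1 /H2 {}H2] /=.
rewrite scalerDr !opprD (addrACA (f1 y)) (addrACA (f1 y - f1 x)).
by rewrite (le_trans (ler_normD _ _))// (splitr e) mulrDl lerD.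
Qed.

Lemma half_line_derivativeZ a f g : half_line_derivative f g ->
  half_line_derivative (a \*: f) (a \*: g).
Proof.
move=> /half_line_derivativeP H; apply/half_line_derivativeP => x e e0.
have a0 : 0 < `|a| + 1 by rewrite ltr_wpDl.
have ea : 0 < e / (`|a| + 1) by rewrite divr_gt0.
have [d d0 {}H] := H x _ ea; exists d => // y /H {}H /=.
rewrite scalerA (mulrC _ a) -scalerA -!scalerBr normrZ.
rewrite (le_trans (ler_wpM2l (normr_ge0 a) H))// mulrA ler_wpM2r//.
by rewrite mulrCA ler_piMr ?(ltW e0)// ler_pdivrMr// mul1r lerDl.
Qed.

Lemma half_line_derivative_scale (u du : R -> R) (v : V) :
  (forall s : R, s <= 0 -> is_derive s 1 u (du s)) ->
  half_line_derivative (fun x => u (\val x) *: v) (fun x => du (\val x) *: v).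
Proof.
move=> udu; apply/half_line_derivativeP => x e e0.
have v0 : 0 < `|v| + 1 by rewrite ltr_wpDl.
have ev : 0 < e / (`|v| + 1) by rewrite divr_gt0.
have [d d0 H] := is_derive_estimate (udu _ (half_line_le0 x)) ev.
exists d => // y /H {}H; rewrite scalerA -!scalerBl normrZ.
rewrite (le_trans (ler_wpM2r (normr_ge0 v) H))// mulrAC ler_wpM2r//.
by rewrite mulrAC ler_pdivrMr// ler_wpM2l ?(ltW e0)// lerDl.
Qed.

Definition half_line_shift (d : R) x := clamp (\val x - d).

Lemma val_half_line_shift d x : 0 <= d -> \val (half_line_shift d x) = \val x - d.
Proof. by move=> d0; rewrite val_clamp//; have := half_line_le0 x; lra. Qed.

Lemma half_line_derivative_shift d f g : 0 <= d -> half_line_derivative f g ->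
  half_line_derivative (f \o half_line_shift d) (g \o half_line_shift d).
Proof.
move=> d0 /half_line_derivativeP H; apply/half_line_derivativeP => x e e0.
have [r r0 {}H] := H (half_line_shift d x) e e0; exists r => // y xy.
have := H (half_line_shift d y); rewrite !val_half_line_shift//.
by rewrite !opprB !(addrA (_ - d)) !subrK; apply.
Qed.

Lemma BUC_shift_is_BUC d phi : 0 <= d -> is_BUC eta (phi \o half_line_shift d).
Proof.
move=> d0; have [_ _ /unif_continuous_half_lineP phiu] := BUCP phi.
have wE x : weighted eta (phi \o half_line_shift d) x =
    expR (eta * d) *: weighted eta phi (half_line_shift d x).
  rewrite /weighted scalerA -expRD val_half_line_shift//.
  by rewrite mulrBr addrC subrK.
apply: (@is_BUC_weighted (expR (eta * d) * `|phi|)).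
  move=> x; rewrite wE normrZ gtr0_norm ?expR_gt0// ler_pM2l ?expR_gt0//.
  by rewrite normrZ gtr0_norm ?expR_gt0//; exact: BUC_norm_ub.
apply/unif_continuous_half_lineP => e e0.
have ed : 0 < e / expR (eta * d) by rewrite divr_gt0// expR_gt0.
have [r r0 H] := phiu _ ed; exists r => // x y xy.
rewrite !wE -scalerBr normrZ gtr0_norm ?expR_gt0// -ler_pdivlMl ?expR_gt0// mulrC.
apply: H; rewrite !val_half_line_shift//.
by rewrite !opprB !(addrA (_ - d)) !subrK.
Qed.

End Criteria.

(** * Density of the generator domain *)

Section Density.
Context (R : realType) (V : normedModType R) (eta : R) (eta0 : 0 < eta).
Local Notation BUC := (BUC V eta).
Implicit Types (f g : half_line R -> V) (phi psi : BUC) (x y : half_line R).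

Lemma expR_near1 (e : R) : 0 < e ->
  exists2 d, 0 < d & forall h, h < d -> expR (eta * h) - 1 <= e.
Proof.
move=> e0; have e1 : 0 < ln (1 + e) by rewrite ln_gt0// ltrDl.
exists (ln (1 + e) / eta) => [|h hd]; first by rewrite divr_gt0.
rewrite lerBlDl -[leRHS]lnK ?posrE ?addr_gt0// ler_expR mulrC.
by rewrite -ler_pdivlMr// ltW.
Qed.

(** Passes between the oscillation of a function and that of its weighted
    version; both coefficients are harmless for close arguments. *)
Lemma weightedB f x y : weighted eta f x - weighted eta f y =
  expR (eta * \val x) *: (f x - f y)
    + (expR (eta * (\val x - \val y)) - 1) *: weighted eta f y.
Proof.
rewrite /weighted scalerA mulrBl -expRD mul1r -mulrDr subrK scalerBl scalerBr.
by rewrite subrKA.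
Qed.

Lemma weighted_norm f x : `|weighted eta f x| = expR (eta * \val x) * `|f x|.
Proof. by rewrite normrZ gtr0_norm ?expR_gt0. Qed.

Lemma weighted_BUC_le phi x : `|weighted eta phi x| <= `|phi|.
Proof. by rewrite weighted_norm; exact: BUC_norm_ub. Qed.

(** Bounds on the weighted function and on its weighted derivative control, by
    [weightedB] and the mean value inequality, the increments of the weighted
    function uniformly in the base point. *)
Lemma is_BUC_C1 (B C : R) f g : half_line_derivative f g ->
  (forall x, `|weighted eta f x| <= B) -> (forall x, `|weighted eta g x| <= C) ->
  is_BUC eta f.
Proof.
move=> fg fB gC; apply: (is_BUC_weighted fB).
apply/unif_continuous_half_lineP => e e0.
have B0 : 0 <= B by exact: le_trans (fB (half_line0 R)).
have C0 : 0 <= C by exact: le_trans (gC (half_line0 R)).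
have eB : 0 < e / 2 / (B + 1) by rewrite !divr_gt0// ltr_wpDl.
have eC : 0 < e / 2 / (2 * C + 1) by rewrite !divr_gt0// ltr_wpDl// mulr_ge0.
have [d1 d10 H1] := expR_near1 ltr01.
have [d2 d20 H2] := expR_near1 eB.
exists (Num.min (e / 2 / (2 * C + 1)) (Num.min d1 d2)); first by rewrite !lt_min eC d10.
move=> x y; wlog yx : x y / \val y <= \val x => [H|].
  by have [/H//|/ltW/H] := leP (\val y) (\val x); rewrite distrC (distrC (weighted _ _ _)).
rewrite ger0_norm ?subr_ge0// !lt_min => /andP[h0 /andP[/H1 h1 /H2 h2]].
have h_ge0 : 0 <= \val x - \val y by rewrite subr_ge0.
set h := \val x - \val y in h0 h1 h2 h_ge0.
rewrite weightedB (le_trans (ler_normD _ _))// (splitr e) lerD//.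
  have mv : `|f x - f y| <= C * expR (- (eta * \val y)) * h.
    rewrite -{1}(clampK x) -{1}(clampK y); apply: half_line_mean_value fg _ _ _ _ => //.
    - exact: half_line_le0.
    - by rewrite mulr_ge0// expR_ge0.
    move=> s /andP[ys sx]; have s0 : s <= 0 by rewrite (le_trans sx)// half_line_le0.
    have := gC (clamp s); rewrite weighted_norm val_clamp// => gs.
    rewrite -ler_pdivlMl ?expR_gt0// in gs; rewrite (le_trans gs)// mulrC.
    by rewrite ler_wpM2l// -expRN ler_expR lerN2 ler_wpM2l// ltW.
  rewrite normrZ gtr0_norm ?expR_gt0// (le_trans (ler_wpM2l (expR_ge0 _) mv))//.
  rewrite [leLHS](_ : _ = C * expR (eta * h) * h); last first.
    rewrite (_ : eta * h = eta * \val x - eta * \val y) ?mulrBr// expRD.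
    ring.
  rewrite ltr_pdivlMr ?ltr_wpDl ?mulr_ge0// in h0.
  rewrite (le_trans _ (ltW h0))// mulrC ler_wpM2l// (@le_trans _ _ (C * 2))//.
    by rewrite ler_wpM2l//; lra.
  by rewrite mulrC lerDl.
rewrite normrZ; have -> : `|expR (eta * h) - 1| = expR (eta * h) - 1.
  by rewrite ger0_norm// subr_ge0 -expR0 ler_expR mulr_ge0// ltW.
rewrite (le_trans (ler_pM _ _ h2 (fB y)))//.
  by rewrite subr_ge0 -expR0 ler_expR mulr_ge0// ltW.
by rewrite mulrAC ler_pdivrMr ?ltr_wpDl// ler_wpM2l ?lerDl// divr_ge0// ltW.
Qed.

Lemma is_BUC_exp (k : R) (v : V) : 0 <= k ->
  is_BUC eta (fun x => expR (k * \val x) *: v).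
Proof.
move=> k0.
have E1 x : expR (eta * \val x) * expR (k * \val x) <= 1.
  rewrite -expRD -mulrDl -expR0 ler_expR mulr_ge0_le0 ?half_line_le0//.
  by rewrite addr_ge0// ltW.
have fg : half_line_derivative (fun x => expR (k * \val x) *: v)
    (fun x => (k * expR (k * \val x)) *: v).
  apply: (@half_line_derivative_scale _ _ (fun s => expR (k * s)) (fun s => k * expR (k * s))).
  by move=> s _; apply: is_derive_eq; rewrite -[k%:A]/(k * 1) mulr1 mulrC.
apply: (@is_BUC_C1 `|v| (k * `|v|) _ _ fg) => x; rewrite weighted_norm normrZ.
  by rewrite gtr0_norm ?expR_gt0// mulrA ler_piMl.
rewrite normrM ger0_norm// gtr0_norm ?expR_gt0// -mulrA mulrCA ler_wpM2l//.
by rewrite mulrA ler_piMl.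
Qed.

Lemma BUC_oscillation phi (e : R) : 0 < e -> exists2 d, 0 < d &
  forall x y, 0 <= \val x - \val y < d ->
    expR (eta * \val x) * `|phi x - phi y| <= e.
Proof.
move=> e0; have [_ _ /unif_continuous_half_lineP phiu] := BUCP phi.
have e2 : 0 < e / 2 by rewrite divr_gt0.
have p0 : 0 < `|phi| + 1 by rewrite ltr_wpDl.
have e3 : 0 < e / 2 / (`|phi| + 1) by rewrite divr_gt0.
have [d1 d10 H1] := phiu _ e2; have [d2 d20 H2] := expR_near1 e3.
exists (Num.min d1 d2) => [|x y]; first by rewrite lt_min d10.
rewrite lt_min => /andP[h0 /andP[h1 /H2 h2]].
rewrite -[expR _ in leLHS]gtr0_norm ?expR_gt0// -normrZ.
rewrite (_ : _ *: _ = weighted eta phi x - weighted eta phi y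
    - (expR (eta * (\val x - \val y)) - 1) *: weighted eta phi y); last first.
  by rewrite weightedB addrK.
rewrite (le_trans (ler_normB _ _))// (splitr e) lerD//.
  by apply: H1; rewrite ger0_norm.
have E0 : 0 <= expR (eta * (\val x - \val y)) - 1.
  by rewrite subr_ge0 -expR0 ler_expR mulr_ge0// ltW.
rewrite normrZ (ger0_norm E0) (le_trans (ler_pM E0 _ h2 (weighted_BUC_le phi y)))//.
by rewrite mulrAC ler_pdivrMr// ler_wpM2l ?lerDl// ltW.
Qed.

Hypothesis primitive : forall f, continuous f ->
  exists F, half_line_derivative F f.

(** Average [phi] over [[x - r, x]]: with a primitive [F], the function [(F x
    - F (x - r)) / r] has the derivative [(phi x - phi (x - r)) / r], which
    lies in BUC, and differs from [phi] by at most the oscillation of [phi] at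
    scale [r]. *)
Lemma BUC_C1_dense phi (e : R) : 0 < e ->
  exists f g : BUC, BUC_derivative f g /\ `|f - phi| <= e.
Proof.
move=> e0; have [phic _ _] := BUCP phi.
have [F Fphi] := primitive phic.
have [d d0 osc] := BUC_oscillation phi e0.
pose r := d / 2; have r0 : 0 < r by rewrite divr_gt0.
have rd : r < d by rewrite ltr_pdivrMr// ltr_pMr// ltr1n.
pose S := half_line_shift (R := R) r.
pose sphi : BUC := MkBUC (mem_set (BUC_shift_is_BUC phi (ltW r0))).
pose g : BUC := r^-1 *: (phi - sphi).
pose f x : V := r^-1 *: (F x - F (S x)).
have fg : half_line_derivative f g.
  have := half_line_derivative_shift (ltW r0) Fphi.
  move=> /(half_line_derivativeZ (a := -1))/(half_line_derivativeD Fphi).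
  move=> /(half_line_derivativeZ (a := r^-1)).
  rewrite (_ : r^-1 \*: _ = f).
    by rewrite (_ : r^-1 \*: _ = g)//; apply/funext => x; rewrite /= scaleN1r.
  by apply/funext => x; rewrite /= scaleN1r.
have fphi x : expR (eta * \val x) * `|f x - phi x| <= e.
  have x0 := half_line_le0 x; have Sx : \val (S x) = \val x - r.
    by rewrite val_half_line_shift// ltW.
  (* The increment of [F s - s * phi x] over the window is the error of the
     average, and its slope is the oscillation [phi s - phi x]. *)
  have Gder := half_line_derivativeD Fphi (@half_line_derivative_scale _ _
    (fun s => s) (fun=> 1) (- phi x) (fun s _ => is_derive_id s 1)).
  have := @half_line_mean_value _ _ _ _ (\val x - r) (\val x)
    (expR (- (eta * \val x)) * e) Gder.
  rewrite !clampK -/(S x) gerBl subKr => /(_ (ltW r0) x0) H.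
  have {H} : `|F x - F (S x) - r *: phi x| <= expR (- (eta * \val x)) * e * r.
    have -> : F x - F (S x) - r *: phi x =
      (F \+ (fun y => \val y *: - phi x)) x - (F \+ (fun y => \val y *: - phi x)) (S x).
      rewrite -[RHS]/((F x + \val x *: - phi x) - (F (S x) + \val (S x) *: - phi x)).
      rewrite Sx !scalerN opprD opprK addrACA; congr (_ + _).
      by rewrite addrC -scalerBl addrAC subrr add0r scaleNr.
    apply: H; first by rewrite mulr_ge0 ?expR_ge0// ltW.
    move=> s /andP[xs sx]; have s0 : s <= 0 by exact: le_trans x0.
    rewrite /= scale1r -ler_pdivrMl ?expR_gt0// -expRN opprK distrC.
    apply: osc; rewrite val_clamp//; apply/andP; split; lra.
  move=> H; rewrite /f -[phi x in leLHS](scalerK (lt0r_neq0 r0)) -scalerBr normrZ.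
  rewrite gtr0_norm ?invr_gt0// mulrCA ler_pdivrMl// -ler_pdivlMl ?expR_gt0//.
  by rewrite (le_trans H)// -expRN -mulrA (mulrC e).
have fB : is_BUC eta f.
  apply: (@is_BUC_C1 (e + `|phi|) `|g| _ _ fg) => x.
    rewrite -(subrK (weighted eta phi x) (weighted eta f x)).
    rewrite (le_trans (ler_normD _ _))// lerD ?weighted_BUC_le//.
    by rewrite /weighted -scalerBr normrZ gtr0_norm ?expR_gt0.
  exact: weighted_BUC_le.
exists (MkBUC (mem_set fB)), g; split=> //.
by apply: BUC_norm_le => x; exact: fphi.
Qed.

Variable L : {linear BUC -> V}.
Hypothesis L_bounded : exists M : R, forall phi, `|L phi| <= M * `|phi|.
Hypothesis injective_surjective : forall G : V -> V, linear G ->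
  injective G -> forall w, exists v, G v = w.

(** After a smooth approximation [f], the boundary condition is restored by
    adding [d * exp (x / d) * c]: this has norm at most [d * |c|] but slope
    [c] at [0]. The equation for [c] is a small perturbation of the identity,
    hence injective, hence solvable in finite dimension; that finiteness
    enters through [injective_surjective]. *)
Lemma BUC_domain_dense phi (e : R) : 0 < e -> exists f g : BUC,
  [/\ BUC_derivative f g, g (half_line0 R) = L f & `|f - phi| <= e].
Proof.
move=> e0; have [M LM] := L_bounded.
have e2 : 0 < e / 2 by rewrite divr_gt0.
have [f [g [fg fphi]]] := BUC_C1_dense phi e2.
pose M1 := `|M| + 1; have M10 : 0 < M1 by rewrite ltr_wpDl.
have LM1 psi : `|L psi| <= M1 * `|psi|.
  rewrite (le_trans (LM psi))// ler_wpM2r// (le_trans (ler_norm M))//.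
  by rewrite lerDl.
pose b := g (half_line0 R) - L f.
(* The first bound makes the equation for [c] solvable with [|c| <= 2 * |b|];
   the second makes the correction at most [e / 2]. *)
pose d := Num.min (1 / 2 / M1) (e / 2 / (2 * (`|b| + 1))).
have b1 : 0 < `|b| + 1 by rewrite ltr_wpDl.
have d0 : 0 < d by rewrite lt_min !divr_gt0// mulr_gt0.
have kd : 0 <= d^-1 by rewrite invr_ge0 ltW.
pose E v : BUC := MkBUC (mem_set (is_BUC_exp v kd)).
have E_lin a u v : E (a *: u + v) = a *: E u + E v.
  apply/val_inj/funext => x; rewrite -[RHS]/(a *: E u x + E v x) /=.
  by rewrite scalerDr !scalerA mulrC.
have E_norm v : `|E v| <= `|v|.
  apply: BUC_norm_le => x; rewrite /= normrZ gtr0_norm ?expR_gt0// mulrA ler_piMl//.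
  rewrite -expRD -mulrDl -expR0 ler_expR mulr_ge0_le0 ?half_line_le0//.
  by rewrite addr_ge0// ltW.
have Lsmall v : `|d *: L (E v)| <= `|v| / 2.
  rewrite normrZ gtr0_norm// (@le_trans _ _ (d * (M1 * `|v|)))//.
    by rewrite ler_pM2l// (le_trans (LM1 _))// ler_pM2l.
  rewrite mulrA mulrC ler_wpM2l// -ler_pdivlMr//.
  by rewrite ge_min (_ : 2^-1 / M1 = 1 / 2 / M1) ?lexx// mul1r.
pose G v := v - d *: L (E v).
have G_lin : linear G.
  move=> a u v; rewrite /G E_lin linearP scalerDr opprD addrACA scalerBr.
  by congr (_ - _ + _); rewrite !scalerA mulrC.
have G_low v : `|v| <= 2 * `|G v|.
  have := ler_normD (G v) (d *: L (E v)); rewrite subrK => H.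
  have := Lsmall v => ?; lra.
have G_inj : injective G.
  move=> u v uv; apply/eqP; rewrite -subr_eq0 -normr_le0.
  have GB : G (u - v) = 0 by rewrite addrC -scaleN1r G_lin scaleN1r uv addNr.
  by rewrite (le_trans (G_low _))// GB normr0 mulr0.
have [c Gc] := injective_surjective G_lin G_inj (- b).
have derE : half_line_derivative (d \*: (E c : half_line R -> V)) (E c).
  have H : half_line_derivative (E c) (fun x => (d^-1 * expR (d^-1 * \val x)) *: c).
    apply: (@half_line_derivative_scale _ _ (fun s => expR (d^-1 * s))
      (fun s => d^-1 * expR (d^-1 * s))).
    by move=> s _; apply: is_derive_eq; rewrite -[d^-1%:A]/(d^-1 * 1) mulr1 mulrC.
  have := half_line_derivativeZ (a := d) H; congr half_line_derivative.
  by apply/funext => x; rewrite /= scalerA mulrA divff ?gt_eqF// mul1r.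
exists (f + d *: E c), (g + E c); split.
- exact: half_line_derivativeD fg derE.
- rewrite BUCD /= mulr0 expR0 scale1r linearD linearZ /=.
  rewrite [X in _ + X = _](_ : c = G c + d *: L (E c)); last by rewrite subrK.
  by rewrite Gc /b opprB addrA [X in X + _]addrC subrK.
rewrite addrAC (le_trans (ler_normD _ _))// (splitr e) lerD//.
rewrite normrZ gtr0_norm// (le_trans (ler_wpM2l (ltW d0) (E_norm c)))//.
have cb : `|c| <= 2 * (`|b| + 1).
  by have := G_low c; rewrite Gc normrN; lra.
rewrite (le_trans (ler_wpM2l (ltW d0) cb))// -ler_pdivlMr ?mulr_gt0//.
by rewrite ge_min lexx orbT.
Qed.

End Density.

(** * Finite-dimensional facts for an arbitrary norm *)

(** The fundamental theorem of calculus gives a primitive to the right of the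
    base point [-1] only; reflecting [f] turns the negative half-line into
    such a region. *)
Lemma continuous_primitive (R : realType) (f : R -> R) : continuous f ->
  exists F : R -> R, forall x : R, x <= 0 -> is_derive x 1 F (f x).
Proof.
move=> fc; pose g y := f (- y).
have gc : continuous g.
  by move=> y; apply: (@continuous_comp _ _ _ -%R f); [exact: opp_continuous|exact: fc].
pose G x := \int[lebesgue_measure]_(t in `[-1, x]) g t.
have G' (y : R) : 0 <= y -> is_derive y 1 G (g y).
  move=> y0; have [||||dG eG] := @continuous_FTC1_closed R g (-1) y (y + 1).
  - by rewrite ltrDl.
  - apply: continuous_compact_integrable; first exact: segment_compact.
    exact: continuous_subspaceT.
  - by rewrite (lt_le_trans _ y0)// oppr_lt0.
  - exact: gc.
  apply: DeriveDef; first exact: dG.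
  by rewrite -derive1E; exact: eG.
exists (fun x => - G (- x)) => x x0.
have H : is_derive (- x) 1 G (f x) by rewrite -[x in f x]opprK; apply: G'; rewrite oppr_ge0.
have -> : f x = - (f x * -1) by rewrite mulrN1 opprK.
apply: is_deriveN; exact: (@is_derive1_comp R G -%R).
Qed.

Section FiniteDimension.
Context (R : realType) (n : nat) (N : rVnorm R n).
Local Notation V := (normed_rV N).
Implicit Types (v w : V).

Lemma normed_rV_upper : exists2 C, 0 < C & forall v b, 0 <= b ->
  (forall j, `|(v : 'rV[R]_n) 0 j| <= b) -> `|v| <= C * b.
Proof.
have Nsum (I : Type) (r : seq I) (F : I -> V) :
    `|\sum_(i <- r) F i| <= \sum_(i <- r) `|F i| by exact: ler_norm_sum.
exists (\sum_(j < n) `|delta_mx 0 j : V| + 1).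
  by rewrite ltr_wpDl// sumr_ge0.
move=> v b b0 vb; rewrite [v]row_sum_delta (le_trans (Nsum _ _ _))//.
rewrite mulrDl mul1r ler_wpDr// mulr_suml ler_sum// => j _.
by rewrite (normrZ ((v : 'rV[R]_n) 0 j) (delta_mx 0 j : V)) mulrC ler_wpM2l.
Qed.

(** Equivalence of norms: [N] is continuous for the maximum norm, so on the
    compact unit sphere of the latter it has a positive minimum. *)
Lemma normed_rV_lower : exists2 C, 0 < C & forall v j,
  `|(v : 'rV[R]_n) 0 j| <= C * `|v|.
Proof.
have [C C0 NC] := normed_rV_upper.
have coord0 j : ((0 : V) : 'rV[R]_n) 0 j = 0 by rewrite -[LHS]/((0 : 'rV[R]_n) 0 j) mxE.
have coord (x : 'rV[R]_n) j : `|x 0 j| <= `|x|.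
  rewrite -[leRHS]/(mx_norm x) mx_normrE.
  by apply/bigmax_geP; right => /=; exists (0, j).
have Nmx (x : 'rV[R]_n) : N x <= C * `|x| by apply: NC => // j; exact: coord.
have Nc : continuous (N : 'rV[R]_n -> R).
  move=> x; apply/(@cvgrPdist_le _ _ _ (nbhs x) _) => e e0.
  have eC : 0 < e / C by rewrite divr_gt0.
  have : \forall y \near x, `|x - y| <= e / C.
    by have /(@cvgrPdist_le _ _ _ (nbhs x) _)/(_ _ eC) := @cvg_id _ (nbhs x).
  apply: filterS => y xy.
  apply: le_trans (ler_dist_dist (x : V) (y : V)) _.
  by rewrite (le_trans (Nmx (x - y)))// mulrC -ler_pdivlMr.
pose S : set 'rV[R]_n := [set x | `|x| = 1].
have normc : continuous (fun x : 'rV[R]_n => `|x|) by exact: norm_continuous.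
have Sc : compact S.
  apply: bounded_closed_compact.
    by exists 1; split=> // r /ltW r1 x /= ->.
  apply: (@preimage_closed _ _ (fun x : 'rV[R]_n => `|x|) [set r : R | r = 1]).
    by move=> x _; exact: normc.
  exact: (@closed_eq R).
have [S0|S0] := pselect (S !=set0); last first.
  exists 1 => // v j; have [->|v0] := eqVneq v 0.
    by rewrite coord0 !normr0 mulr0.
  exfalso; apply: S0; exists (`|v : 'rV[R]_n|^-1 *: (v : 'rV[R]_n)).
  by rewrite /S /= normrZ normfV normr_id mulVf// normr_eq0.
have [x Sx xmin] := compact_EVT_min S0 Sc (continuous_subspaceT Nc).
have Nx0 : 0 < N x.
  rewrite -[N x]/(`|x : V|) normr_gt0; apply/eqP => x0'.
  have x0 : x = (0 : 'rV[R]_n) := x0'.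
  by move: Sx; rewrite inE /S /= x0 normr0 => /eqP; rewrite eq_sym oner_eq0.
exists (N x)^-1; first by rewrite invr_gt0.
move=> v j; have [->|v0] := eqVneq v 0.
  by rewrite coord0 !normr0 mulr0.
have v1 : 0 < `|v : 'rV[R]_n| by rewrite normr_gt0.
rewrite (le_trans (coord v j))// mulrC ler_pdivlMr// mulrC.
have := xmin (`|v : 'rV[R]_n|^-1 *: (v : 'rV[R]_n)).
rewrite rVnormZ normfV normr_id ler_pdivlMl// mulrC; apply.
by rewrite inE /S /= normrZ normfV normr_id mulVf// gt_eqF.
Qed.

Lemma normed_rV_injective_surjective (G : V -> V) : linear G -> injective G ->
  forall w, exists v, G v = w.
Proof.
move=> Glin Ginj w.
pose GL := GRing.isLinear.Build R 'rV[R]_n 'rV[R]_n *:%R (G : 'rV[R]_n -> 'rV[R]_n) Glin.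
pose G' : {linear 'rV[R]_n -> 'rV[R]_n} := HB.pack (G : 'rV[R]_n -> 'rV[R]_n) GL.
pose A := lin1_mx G'.
have GA (u : 'rV[R]_n) : u *m A = G u by rewrite (mul_rV_lin1 G').
have Au : A \in unitmx.
  rewrite -row_free_unit; apply/inj_row_free => u uA.
  apply: Ginj; rewrite -[LHS]GA uA; exact/esym/(linear0 G').
by exists ((w : 'rV[R]_n) *m invmx A); rewrite -[LHS]GA mulmxKV.
Qed.

(** Total boundedness of balls, with the cells of a grid in coordinates: this
    form produces finite covers without exhibiting their centers. *)
Lemma normed_rV_finite_partition (b e : R) : 0 < e ->
  exists (I : finType) (c : V -> I), forall v w, `|v| <= b -> `|w| <= b ->
    c v = c w -> `|v - w| <= e.
Proof.
move=> e0; have [C C0 upper] := normed_rV_upper.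
have [D D0 lower] := normed_rV_lower.
have [d d0 ->] : exists2 d, 0 < d & e = C * d.
  by exists (e / C); rewrite ?divr_gt0// mulrC divfK// gt_eqF.
pose m := Num.truncn (2 * (D * b) / d).
pose cell (x : R) : 'I_m.+1 := inord (Num.truncn ((x + D * b) / d)).
exists {ffun 'I_n -> 'I_m.+1}, (fun v => [ffun j => cell ((v : 'rV[R]_n) 0 j)]).
move=> v w vb wb /ffunP cvw.
apply: upper; first exact: ltW.
move=> j; have := cvw j; rewrite !ffunE mxE mxE => /(congr1 val) /=.
have bound (u : V) : `|u| <= b -> 0 <= ((u : 'rV[R]_n) 0 j + D * b) / d <= 2 * (D * b) / d.
  move=> ub; have : `|(u : 'rV[R]_n) 0 j| <= D * b.
    by rewrite (le_trans (lower u j))// ler_pM2l.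
  rewrite ler_norml => /andP[u1 u2]; apply/andP; split.
    by apply: divr_ge0; [lra|exact: ltW].
  by rewrite ler_pM2r ?invr_gt0//; lra.
have lt_m x : 0 <= x <= 2 * (D * b) / d -> (Num.truncn x < m.+1)%N.
  by move=> /andP[x0 xb]; rewrite ltnS; apply: le_truncn.
have vm := lt_m _ (bound v vb); have /andP[v0 _] := bound v vb.
have wm := lt_m _ (bound w wb); have /andP[w0 _] := bound w wb.
rewrite !inordK// => tvw.
have := truncn_itv v0; have := truncn_itv w0; rewrite tvw.
set t := Num.truncn _; rewrite -natr1.
set x := (v : 'rV[R]_n) 0 j; set y := (w : 'rV[R]_n) 0 j.
rewrite !ler_pdivlMr// !ltr_pdivrMr// => /andP[y1 y2] /andP[x1 x2].
by rewrite ler_norml; apply/andP; split; lra.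
Qed.

Lemma normed_rV_unit_vector : (0 < n)%N -> exists v : V, `|v| = 1.
Proof.
move=> n0; pose u : V := const_mx 1.
have u0 : u != 0.
  apply/eqP => /(congr1 (fun v : V => (v : 'rV[R]_n) 0 (Ordinal n0))).
  by rewrite /= !mxE => /eqP; rewrite oner_eq0.
exists (`|u|^-1 *: u); rewrite normrZ normfV normr_id mulVf//.
by rewrite normr_eq0.
Qed.

(** A primitive is taken in each coordinate; the common radius in the
    definition of the derivative is the minimum over the finitely many
    coordinates. *)
Lemma normed_rV_primitive (f : half_line R -> V) : continuous f ->
  exists F, half_line_derivative F f.
Proof.
move=> fc; have [C C0 upper] := normed_rV_upper.
have [D D0 lower] := normed_rV_lower.
pose fj j (s : R) := (f (clamp s) : 'rV[R]_n) 0 j.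
have fjc j : continuous (fj j).
  move=> s; apply/cvgrPdist_le => e e0.
  have eD : 0 < e / D by rewrite divr_gt0.
  have [d d0 H] := continuous_clamp s fc eD.
  exists d => //= t st; have := lower (f (clamp s) - f (clamp t)) j.
  rewrite !mxE => /le_trans; apply; rewrite mulrC -ler_pdivlMr//.
  exact: H.
have [F FP] : exists F : 'I_n -> R -> R, forall j (x : R), x <= 0 ->
    is_derive x 1 (F j) (fj j x).
  have H j := cid (continuous_primitive (fjc j)).
  by exists (fun j => projT1 (H j)) => j; exact: (projT2 (H j)).
exists (fun x => (\row_j F j (\val x) : 'rV[R]_n) : V).
apply/half_line_derivativeP => x e e0.
have eC : 0 < e / C by rewrite divr_gt0.
have dj j : exists2 d, 0 < d & forall y, `|\val x - y| < d ->
    `|F j y - F j (\val x) - (y - \val x) * fj j (\val x)| <= e / C * `|\val x - y|.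
  exact: is_derive_estimate (FP j _ (half_line_le0 x)) eC.
have [d d0 H] : exists2 d, 0 < d & forall j y, `|\val x - y| < d ->
    `|F j y - F j (\val x) - (y - \val x) * fj j (\val x)| <= e / C * `|\val x - y|.
  pose dd j := s2val (cid2 (dj j)).
  exists (\big[Num.min/1]_j dd j).
    by elim/big_ind : _ => // [a b a0 b0|j _]; [rewrite lt_min a0|exact: (s2valP (cid2 (dj j)))].
  move=> j y xy; apply: (s2valP' (cid2 (dj j))).
  by rewrite (lt_le_trans xy)//; exact: bigmin_le_cond.
exists d => // y xy.
rewrite (_ : e * _ = C * (e / C * `|\val x - \val y|)); last first.
  by rewrite mulrA (mulrC C) divfK// gt_eqF.
apply: upper; first by rewrite mulr_ge0// ltW.
move=> j; rewrite !mxE; have := H j _ xy; rewrite /fj clampK.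
done.
Qed.

End FiniteDimension.

(** * Essential norms, and bumps for the lower bound *)

Section EssNorm.
Context (R : realType) (X : normedModType R).
Implicit Types (Y : set X) (F : X -> X).

(** Each class that meets the unit ball contributes the ball around the image
    of one of its members. *)
Lemma ess_norm_le Y F (I : finType) (c : X -> I) (e : R) : 0 < e -> Y 0 ->
  (forall x, Y x -> Y (F x)) ->
  (forall x y, Y x -> Y y -> `|x| <= 1 -> `|y| <= 1 -> c x = c y ->
     `|F x - F y| <= e) ->
  (ess_norm Y F <= e%:E)%E.
Proof.
move=> e0 Y0 YF cF; apply: ereal_inf_lbound; exists e => //; split=> //.
have rep i : exists x, [/\ Y x, `|x| <= 1 & forall y, Y y -> `|y| <= 1 ->
    c y = i -> c x = i].
  have [[y [Yy y1 cy]]|no] := pselect (exists y, [/\ Y y, `|y| <= 1 & c y = i]).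
    by exists y; split.
  exists 0; split; rewrite ?normr0// => y Yy y1 cy.
  by exfalso; apply: no; exists y.
pose r i := projT1 (cid (rep i)).
exists [seq (F (r i), e) | i <- enum I]; split.
  move=> _ /mapP[i _ ->] /=; split=> //; apply: YF.
  by have [] := projT2 (cid (rep i)).
move=> _ [x [Yx /= x1] <-]; rewrite /closed_ball_/= sub0r normrN in x1.
exists (F (r (c x)), e).
  by apply/mapP; exists (c x) => //; rewrite mem_enum.
split; first exact: YF.
have [Yr r1 cr] := projT2 (cid (rep (c x))).
by apply: cF => //; exact: cr Yx x1 erefl.
Qed.

(** By pigeonhole, in any finite cover two of the points [F (x k)] share a
    ball, so its diameter is at least [d]. *)
Lemma ess_norm_ge Y F (x : nat -> X) (d : R) :
  (forall k, Y (x k) /\ `|x k| <= 1) ->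
  (forall j k, j != k -> d <= `|F (x j) - F (x k)|) ->
  ((d / 2)%:E <= ess_norm Y F)%E.
Proof.
move=> Yx sep; apply: le_ereal_inf_tmp => _ [e [e0 [s [sP sC]]] <-].
rewrite lee_fin.
have cov k : exists2 i : 'I_(size s), let c := nth (0, 0) s i in
    `|c.1 - F (x k)| <= e & True.
  have [Yk xk1] := Yx k.
  have [|c cs [_ /= ck]] := sC (F (x k)).
    by exists (x k) => //; split=> //; rewrite /closed_ball_/= sub0r normrN.
  have ic : (index c s < size s)%N by rewrite index_mem.
  exists (Ordinal ic) => //=; rewrite nth_index// (le_trans ck)//.
  by have [] := sP c cs.
pose f (k : 'I_(size s).+1) : 'I_(size s) := s2val (cid2 (cov k)).
have [j [k [jk fjk]]] : exists j k, j != k /\ f j = f k.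
  apply: contrapT => no; have finj : injective f.
    move=> j k fjk; apply/eqP; apply: contra_notT no => jk.
    by exists j, k.
  by have := leq_card f finj; rewrite !card_ord ltnn.
have := s2valP (cid2 (cov j)); have := s2valP (cid2 (cov k)).
rewrite -/(f j) -/(f k) fjk /= => Hk Hj.
rewrite ler_pdivrMr// (le_trans (sep j k _))//.
rewrite -(subrKA (nth (0, 0) s (f k)).1) (le_trans (ler_normD _ _))//.
by rewrite mulrC mulr_natl mulr2n lerD// distrC.
Qed.

(** The constants [a] and [b] disappear after taking logarithms and dividing
    by [t]. This also shows that the limit exists, without which the growth
    bound would be an arbitrary default value. *)
Lemma ess_growth_bound_eq Y (T : R -> X -> X) (a b w : R) : 0 < a -> 0 < b ->
  (forall t, 0 <= t -> ((a * expR (w * t))%:E <= ess_norm Y (T t)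
     <= (b * expR (w * t))%:E)%E) ->
  ess_growth_bound Y T = w%:E.
Proof.
move=> a0 b0 H; apply/cvg_lim => //.
have lim0 (c : R) : (((ln c + w * t) * t^-1)%:E @[t --> +oo%R] --> w%:E)%E.
  apply: cvg_EFin; first exact: nearW.
  apply/cvgrPdist_le => e e0.
  apply: filterS2 (nbhs_pinfty_gt (num_real 0))
    (nbhs_pinfty_ge (num_real (`|ln c| / e))) => t t0 te.
  rewrite /= mulrDl (mulrK (unitf_gt0 t0)) opprD addrCA subrr addr0 normrN.
  by rewrite normrM normfV (gtr0_norm t0) ler_pdivrMr// mulrC -ler_pdivrMr.
apply: (@squeeze_cvge _ _ _ _ (fun t => ((ln a + w * t) * t^-1)%:E) _ 
  (fun t => ((ln b + w * t) * t^-1)%:E)) => //.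
near=> t; have t0 : 0 < t by near: t; exact: nbhs_pinfty_gt.
have /andP[] := H t (ltW t0).
have pa : 0 < a * expR (w * t) by rewrite mulr_gt0// expR_gt0.
have pb : 0 < b * expR (w * t) by rewrite mulr_gt0// expR_gt0.
have lnE c : 0 < c -> ln c + w * t = ln (c * expR (w * t)).
  by move=> c0; rewrite lnM ?posrE ?expR_gt0// expRK.
case: (ess_norm Y (T t)) => // r; rewrite !lee_fin => ar rb.
have r0 : 0 < r by exact: lt_le_trans ar.
rewrite lne_EFin// -EFinM !lee_fin !lnE// !ler_pM2r ?invr_gt0//.
by rewrite !ler_ln ?posrE// ar.
Unshelve. all: by end_near. Qed.

End EssNorm.

Section TestFunctions.
Context (R : realType) (V : normedModType R) (eta : R) (eta0 : 0 < eta) (v : V).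
Hypothesis v1 : `|v| = 1.
Local Notation BUC := (BUC V eta).

(** Bumps of unit Lipschitz constant centered at [-2 * k], whose supports
    overlap at most at end points; the factor [2] separates them. *)
Definition tent (k : nat) (s : R) : R := Num.max 0 (1 - `|s + k.*2%:R|).

Lemma tent_itv k s : 0 <= tent k s <= 1.
Proof. by rewrite /tent le_max lexx /= ge_max ler01 /= gerBl. Qed.

Lemma tent_lipschitz k s t : `|tent k s - tent k t| <= `|s - t|.
Proof.
have max_lip (a b : R) : `|Num.max 0 a - Num.max 0 b| <= `|a - b|.
  wlog ab : a b / a <= b => [H|].
    by have [/H//|/ltW/H] := leP a b; rewrite distrC (distrC b).
  rewrite distrC (distrC a) (ger0_norm (_ : 0 <= b - a)) ?subr_ge0//.
  by have [a0|a0] := leP 0 a; have [b0|b0] := leP 0 b;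
    rewrite ?subrr ?subr0 ?normr0 ?ger0_norm ?subr_ge0//; lra.
rewrite (le_trans (max_lip _ _))// (_ : _ - _ = `|t + k.*2%:R| - `|s + k.*2%:R|);
  last by ring.
rewrite (le_trans (ler_dist_dist _ _))// distrC.
by rewrite opprD addrACA subrr addr0.
Qed.

Lemma tent_center k : tent k (- k.*2%:R) = 1.
Proof. by rewrite /tent addNr normr0 subr0 max_r. Qed.

Lemma tent_other j k : j != k -> tent j (- k.*2%:R) = 0.
Proof.
move=> jk; rewrite /tent max_l// subr_le0 addrC.
have : (k.*2.+1 <= j.*2)%N || (j.*2.+1 <= k.*2)%N.
  by move: jk; rewrite neq_ltn => /orP[]; lia.
by move=> /orP[]; rewrite -(ler_nat R) -natr1 => H; rewrite ler_normr; apply/orP; [left|right]; lra.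
Qed.

Lemma test_function_is_BUC k :
  is_BUC eta (fun x : half_line R => (expR (- (eta * \val x)) * tent k (\val x)) *: v).
Proof.
set f := (X in is_BUC _ X).
have wE x : weighted eta f x = tent k (\val x) *: v.
  by rewrite /weighted /f scalerA mulrA -expRD subrr expR0 mul1r.
apply: (@is_BUC_weighted _ _ _ 1).
  move=> x; rewrite wE normrZ v1 mulr1 ger0_norm.
    by case/andP: (tent_itv k (\val x)).
  by case/andP: (tent_itv k (\val x)).
apply/unif_continuous_half_lineP => e e0; exists e => // x y xy.
by rewrite !wE -scalerBl normrZ v1 mulr1 (le_trans (tent_lipschitz _ _ _))// ltW.
Qed.

Definition test_function k : BUC := MkBUC (mem_set (test_function_is_BUC k)).

Lemma test_function_norm k : `|test_function k| <= 1.
Proof.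
apply: BUC_norm_le => x; rewrite /= normrZ v1 mulr1 normrM gtr0_norm ?expR_gt0//.
rewrite mulrA -expRD subrr expR0 mul1r ger0_norm.
  by case/andP: (tent_itv k (\val x)).
by case/andP: (tent_itv k (\val x)).
Qed.

Lemma test_function_separated j k : j != k ->
  `|test_function j (clamp (- k.*2%:R)) - test_function k (clamp (- k.*2%:R))| = expR (eta * k.*2%:R).
Proof.
move=> jk; have k0 : - k.*2%:R <= 0 :> R by rewrite oppr_le0.
rewrite -[test_function j _]/((expR (- (eta * \val (clamp (- k.*2%:R)))) *
  tent j (\val (clamp (- k.*2%:R)))) *: v).
rewrite -[test_function k _]/((expR (- (eta * \val (clamp (- k.*2%:R)))) *
  tent k (\val (clamp (- k.*2%:R)))) *: v).
rewrite !val_clamp// tent_center tent_other// mulr0 scale0r sub0r normrN mulr1.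
by rewrite normrZ v1 mulr1 gtr0_norm ?expR_gt0// mulrN opprK.
Qed.

End TestFunctions.

(** * From the product space to BUC, and the growth bounds *)

Section Transfer.
Context (R : realType) (n : nat) (N : rVnorm R n) (eta : R) (eta0 : 0 < eta).
Local Notation V := (normed_rV N).
Local Notation BUC := (BUC V eta).
Local Notation X := (state_space V eta).
Local Notation Y := (X0 V eta).
Implicit Types (phi psi : BUC).

Let embed phi : X := (0, phi).

Let norm_embed phi : `|embed phi| = `|phi|.
Proof. by rewrite -[LHS]/(`|0 : V| + `|phi|) normr0 add0r. Qed.

Let snd_le (p : X) : `|p.2| <= `|p|.
Proof. by rewrite -[leRHS]/(`|p.1| + `|p.2|) lerDr. Qed.

(** The closure contains all of [{0} * BUC] because continuously
    differentiable functions are dense in BUC. *)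
Lemma X0E : Y = [set p | p.1 = 0].
Proof.
apply/seteqP; split=> [p cp|[a phi] /= a0].
  apply/eqP; rewrite -normr_le0; apply/ler_addgt0Pr => e e0.
  have /cp[q [[y [f [g [_ [-> _]]]]]]] : nbhs p (ball p e).
    exact: nbhsx_ballx.
  rewrite -ball_normE /ball_/= => pf; rewrite add0r.
  apply: le_trans (ltW pf); rewrite -[leRHS]/(`|p.1 - 0| + `|p.2 - f|) subr0.
  by rewrite lerDl.
move=> B /nbhs_ballP[e /= e0 eB]; rewrite a0 in eB.
have e2 : 0 < e / 2 by rewrite divr_gt0.
have [f [g [fg fphi]]] := BUC_C1_dense eta0 (@normed_rV_primitive R n N) phi e2.
exists (embed f); split; first by exists (- g (half_line0 R), g), f, g.
apply: eB; rewrite -ball_normE /ball_/= -[ltLHS]/(`|0 - 0 : V| + `|phi - f|).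
rewrite subrr normr0 add0r distrC (le_lt_trans fphi)//.
by rewrite ltr_pdivrMr// ltr_pMr// ltr1n.
Qed.

(** The first component of [A + L] is [L f - g 0]; it vanishes exactly under
    the boundary condition. *)
Lemma op_AL0P (L : BUC -> V) (p : X * X) : op_AL0 L p <->
  exists f g : BUC, [/\ BUC_derivative f g, g (half_line0 R) = L f &
    p = (embed f, embed g)].
Proof.
rewrite /op_AL0 /op_part /= X0E; split.
  case: p => q1 q2 [[y [z [[f [g [fg [/= -> ->]]]] [_ /= ->] /= ->]]] _ /= q0].
  exists f, g; split => //.
    by move: q0 => /eqP; rewrite addrC subr_eq0 => /eqP.
  congr (_, _); rewrite -[LHS]/((- g (half_line0 R) + L f, g + 0) : X).
  by rewrite addr0; congr (_, _).
move=> [f [g [fg gL ->]]]; split => //=.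
exists (- g (half_line0 R), g), (L f, 0); split.
- by exists f, g.
- by split=> //; rewrite X0E.
by rewrite -[RHS]/((- g (half_line0 R) + L f, g + 0) : X) gL addNr addr0.
Qed.

(** This makes the unperturbed semigroup a special case of the perturbed one.
    *)
Lemma op_A0E : op_A0 V eta = op_AL0 (fun=> 0 : V).
Proof.
apply/seteqP; split=> -[p q].
  move=> [[f [g [fg [-> ->]]]] _]; rewrite X0E => /= /eqP.
  rewrite oppr_eq0 => /eqP g0; apply/op_AL0P; exists f, g; split => //.
  by rewrite g0 oppr0.
move=> /op_AL0P[f [g [fg g0 ->]]]; rewrite /op_A0 /op_part /= X0E; split=> //.
by exists f, g; split=> //; rewrite g0 oppr0.
Qed.

Variables (L : {linear BUC -> V}) (T : R -> X -> X).
Hypothesis L_bounded : exists M : R, forall phi, `|L phi| <= M * `|phi|.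
Hypothesis genT : generates Y (op_AL0 L) T.

Let U t phi : BUC := (T t (embed phi)).2.

Let Yembed phi : Y (embed phi). Proof. by rewrite X0E. Qed.

Let TE t phi : 0 <= t -> T t (embed phi) = embed (U t phi).
Proof.
move=> t0; have := C0_stable genT.1 t0 (@Yembed phi); rewrite X0E /= /U.
by case: (T t _) => a b /= ->.
Qed.

Lemma restricted_semigroup : C0_semigroup setT U.
Proof.
have sgT := genT.1; split => //.
- move=> t a x y t0 _ _; rewrite /U.
  have -> : embed (a *: x + y) = a *: embed x + embed y.
    by rewrite -[RHS]/((a *: 0 + 0, a *: x + y) : X) scaler0 addr0.
  by rewrite (C0_linear sgT)//; exact: @Yembed.
- move=> t t0; have [M MP] := C0_bounded sgT t0; exists M => x _.
  by rewrite (le_trans (snd_le _))// (le_trans (MP _ (@Yembed x)))// norm_embed.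
- by move=> x _; rewrite /U (C0_0 sgT).
- by move=> s t x s0 t0 _; rewrite /U (C0_D sgT)// TE.
move=> x _; apply/cvgrPdist_le => e e0.
have /cvgrPdist_le/(_ _ e0) := C0_continuous sgT (@Yembed x).
by apply: filterS => t; apply: le_trans; exact: (snd_le (embed x - _)).
Qed.

Lemma restricted_generator f g : semigroup_generator setT U (f, g) <->
  BUC_derivative f g /\ g (half_line0 R) = L f.
Proof.
(* The generator of [T] is known by hypothesis, and the embedding is an
   isometry onto [X0]. *)
have -> : (BUC_derivative f g /\ g (half_line0 R) = L f) <->
    semigroup_generator Y T (embed f, embed g).
  rewrite genT.2 op_AL0P; split=> [[fg gL]|[f' [g' [fg gL [-> ->]]]]//].
  by exists f, g.
have E h : 0 < h -> embed g - h^-1 *: (T h (embed f) - embed f) =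
    embed (g - h^-1 *: (U h f - f)).
  move=> h0; rewrite TE ?ltW//.
  rewrite -[LHS]/((0 - h^-1 *: (0 - 0), g - h^-1 *: (U h f - f)) : X).
  by rewrite subrr scaler0 subr0.
split=> -[_ /= H].
  split; first exact: @Yembed.
  apply/cvgrPdist_le => e e0; have /cvgrPdist_le/(_ _ e0) := H.
  by apply: filterS2 (nbhs_right_gt 0) => h h0; rewrite /= E// norm_embed.
split=> //; apply/cvgrPdist_le => e e0; have /cvgrPdist_le/(_ _ e0) := H.
by apply: filterS2 (nbhs_right_gt 0) => h h0; rewrite /= E// norm_embed.
Qed.

Let gen_derivative f g : semigroup_generator setT U (f, g) ->
  BUC_derivative f g /\ g (half_line0 R) = L f.
Proof. by move/restricted_generator. Qed.

Let domain_dense phi e : 0 < e ->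
  exists f g, semigroup_generator setT U (f, g) /\ `|f - phi| <= e.
Proof.
move=> e0; have [f [g [fg gL fphi]]] := BUC_domain_dense eta0
  (@normed_rV_primitive R n N) L_bounded (@normed_rV_injective_surjective R n N) phi e0.
by exists f, g; split=> //; apply/restricted_generator.
Qed.

Let L_bounded0 : exists2 M, 0 <= M & forall phi, `|L phi| <= M * `|phi|.
Proof.
have [M LM] := L_bounded; exists `|M| => // phi.
by rewrite (le_trans (LM phi))// ler_wpM2r// ler_norm.
Qed.

Let interior (phi : BUC) (t p : R) : 0 <= t -> p + t <= 0 ->
  U t phi (clamp p) = phi (clamp (p + t)).
Proof. exact: (flow_interior eta0 restricted_semigroup gen_derivative domain_dense). Qed.

(** Two states whose boundary values on [[-t, 0]] are close differ there by
    little, and further left they are translates of elements of the unit ball,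
    at distance at most [2], shrunk by the weight. The boundary values form an
    equi-Lipschitz bounded family, so their cells at finitely many nodes
    decide closeness: this is the argument of Arzela and Ascoli. *)
Lemma flow_finite_classes (t : R) : 0 <= t ->
  exists (I : finType) (c : BUC -> I), forall phi psi,
    `|phi| <= 1 -> `|psi| <= 1 -> c phi = c psi ->
    `|U t phi - U t psi| <= 2 * expR (- eta * t).
Proof.
move=> t0; have [M M0 LM] := L_bounded0; have sgU := restricted_semigroup.
have [C C0 lip] := flow_boundary_lipschitz eta0 sgU gen_derivative M0 LM domain_dense t0.
have [K K0 KP] := semigroup_bounded sgU t0.
set r := 2 * expR (- eta * t).
have r0 : 0 < r by rewrite mulr_gt0// expR_gt0.
have r2 : 0 < r / 2 by rewrite divr_gt0.
have [I [c cP]] := @normed_rV_finite_partition R n N (expR (eta * t) * K) _ r2.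
(* The mesh [d] keeps the two Lipschitz errors below one half of [r]; the
   other half is spent on the cells. *)
have [d d0 Cd] : exists2 d, 0 < d & C * d + C * d <= r / 2.
  have C1 : 0 < C + 1 by rewrite ltr_wpDl.
  exists (r / 4 / (C + 1)); first by rewrite !divr_gt0.
  have : C * (r / 4 / (C + 1)) <= r / 4.
    by rewrite mulrCA ler_piMr ?divr_ge0 ?(ltW r0)// ler_pdivrMr// mul1r lerDl.
  by set x := C * _; lra.
pose m := Num.truncn (t / d).
pose node (i : 'I_m.+1) : R := - (d * i%:R).
exists {ffun 'I_m.+1 -> I}, (fun phi => [ffun i => c (U t phi (clamp (node i)))]).
move=> phi psi phi1 psi1 /ffunP cE.
apply: BUC_norm_le => x; rewrite -[x]clampK val_clamp ?half_line_le0//.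
have := half_line_le0 x; set p := \val x => p0; rewrite BUCB.
have [pt|pt] := leP (p + t) 0.
  rewrite !interior// -BUCB (le_trans (ler_wpM2l (expR_ge0 _) (BUC_eval_le _ _)))//.
  rewrite val_clamp// mulrA -expRD mulrDr opprD addNKr /r mulrC mulNr.
  rewrite ler_pM2r ?expR_gt0// (le_trans (ler_normB _ _))//.
  by rewrite (le_trans (lerD phi1 psi1)).
rewrite (@le_trans _ _ `|U t phi (clamp p) - U t psi (clamp p)|)//.
  by rewrite ler_piMl// -expR0 ler_expR mulr_ge0_le0// ltW.
have pd0 : 0 <= - p / d by rewrite divr_ge0 ?oppr_ge0// ltW.
have /andP[i1 i2] := truncn_itv pd0.
have im : (Num.truncn (- p / d) < m.+1)%N.
  by rewrite ltnS; apply: le_truncn; rewrite ler_pM2r ?invr_gt0//; lra.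
pose i : 'I_m.+1 := Ordinal im; set q := node i.
rewrite ler_pdivlMr// in i1; rewrite ltr_pdivrMr// -natr1 in i2.
have qE : q = - ((Num.truncn (- p / d))%:R * d) by rewrite /q /node mulrC.
set k : R := (Num.truncn (- p / d))%:R in i1 i2 qE.
have kd : 0 <= k * d by rewrite mulr_ge0 ?ler0n// ltW.
have qt : - t <= q <= 0 by apply/andP; split; lra.
have ptb : - t <= p <= 0 by apply/andP; split; lra.
have pq : `|p - q| <= d by rewrite ler_norml; apply/andP; split; lra.
have step chi : `|chi| <= 1 -> `|U t chi (clamp p) - U t chi (clamp q)| <= C * d.
  by move=> chi1; rewrite (le_trans (lip _ _ _ _ _ _))// ler_wpM2l.
have bound chi : `|chi| <= 1 -> `|U t chi (clamp q)| <= expR (eta * t) * K.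
  move=> chi1; rewrite (le_trans (BUC_eval_le _ _))// ler_pM ?expR_ge0//.
    case/andP: qt => qt q0.
    by rewrite val_clamp// ler_expR -mulrN ler_pM2l//; lra.
  by rewrite (le_trans (KP _))// ler_piMr// ltW.
have same : `|U t phi (clamp q) - U t psi (clamp q)| <= r / 2.
  by apply: cP; [exact: bound..|have := cE i; rewrite !ffunE].
rewrite -(subrKA (U t phi (clamp q))) (le_trans (ler_normD _ _))//.
rewrite -[X in _ + `|X|](subrKA (U t psi (clamp q))).
have n1 := step _ phi1; have n2 := step _ psi1; rewrite distrC in n2.
have n3 := ler_normD (U t phi (clamp q) - U t psi (clamp q))
  (U t psi (clamp q) - U t psi (clamp p)).
by lra.
Qed.

Lemma ess_norm_upper (t : R) : 0 <= t ->
  (ess_norm Y (T t) <= (2 * expR (- eta * t))%:E)%E.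
Proof.
move=> t0; have [I [c cP]] := flow_finite_classes t0.
apply: (@ess_norm_le R X Y (T t) I (fun x : X => c x.2)).
- by rewrite mulr_gt0// expR_gt0.
- by rewrite X0E.
- by move=> x; exact: (C0_stable genT.1 t0).
move=> x y; rewrite X0E; case: x => x1 x; case: y => y1 y /= -> ->.
rewrite -/(embed x) -/(embed y) !norm_embed !TE// => x1' y1' cxy.
rewrite -[X in X <= _]/(`|0 - 0 : V| + `|U t x - U t y|).
by rewrite subrr normr0 add0r; exact: cP.
Qed.

(** The translates of the bumps stay separated, by [exp (- eta * t)]. *)
Lemma ess_norm_lower (t : R) : (0 < n)%N -> 0 <= t ->
  ((2^-1 * expR (- eta * t))%:E <= ess_norm Y (T t))%E.
Proof.
move=> n0 t0; have [v v1] := normed_rV_unit_vector N n0.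
rewrite mulrC; apply: (@ess_norm_ge R X Y (T t) (fun k => embed (test_function eta v1 k))).
  by move=> k; split; [exact: @Yembed|rewrite norm_embed test_function_norm].
move=> j k jk; rewrite !TE//.
rewrite -[X in _ <= X]/(`|0 - 0 : V| + `|U t (test_function eta v1 j) - U t (test_function eta v1 k)|).
rewrite subrr normr0 add0r.
(* The center of the [k]-th bump after translation by [t]. *)
pose p : R := - k.*2%:R - t.
have k0 : 0 <= k.*2%:R :> R by [].
have p0 : p <= 0 by rewrite /p; lra.
have pt : p + t = - k.*2%:R by rewrite /p subrK.
have := BUC_norm_ub (U t (test_function eta v1 j) - U t (test_function eta v1 k)) (clamp p).
apply: le_trans; rewrite BUCB !interior ?pt ?oppr_le0// test_function_separated//.
rewrite val_clamp// -expRD ler_expR /p; lra.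
Qed.

(** The value does not depend on [L]: the perturbation only acts through the
    boundary values, which are compact data. *)
Theorem ess_growth_bound_AL0 : (0 < n)%N -> ess_growth_bound Y T = (- eta)%:E.
Proof.
move=> n0; apply: (@ess_growth_bound_eq R X Y T 2^-1 2) => // t t0.
by rewrite ess_norm_lower// ess_norm_upper.
Qed.

End Transfer.

Theorem lemma4p4 (R : realType) (n : nat) (hn : (1 <= n)%N) (N : rVnorm R n)
  (eta : R) (heta : 0 < eta)
  (Lhat : {linear BUC (normed_rV N) eta -> normed_rV N})
  (hLhat : exists M : R,
     forall phi : BUC (normed_rV N) eta, `|Lhat phi| <= M * `|phi|)
  (T0 TL : R -> state_space (normed_rV N) eta -> state_space (normed_rV N) eta)
  (hT0 : generates (X0 (normed_rV N) eta) (op_A0 (normed_rV N) eta) T0)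
  (hTL : generates (X0 (normed_rV N) eta) (op_AL0 Lhat) TL) :
  (ess_growth_bound (X0 (normed_rV N) eta) TL
     <= ess_growth_bound (X0 (normed_rV N) eta) T0)%E /\
  (ess_growth_bound (X0 (normed_rV N) eta) T0 <= (- eta)%:E)%E.
Proof.
have -> := ess_growth_bound_AL0 heta hLhat hTL hn.
have L0 : exists M : R, forall phi : BUC (normed_rV N) eta,
    `|(\0 : {linear BUC (normed_rV N) eta -> normed_rV N}) phi| <= M * `|phi|.
  by exists 0 => phi; rewrite normr0 mul0r.
have -> // : ess_growth_bound (X0 (normed_rV N) eta) T0 = (- eta)%:E.
apply: (@ess_growth_bound_AL0 R n N eta heta \0 T0 L0 _ hn).
by rewrite (op_A0E N heta) in hT0.
Qed.
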